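(* Let $G$ be a finite simple graph with stability number $\alpha(G)=2$. Then the following conditions are equivalent: (i) the stable set polytope $\mathcal{Q}_G$ is normal; (ii) $\mathcal{Q}_G$ has a unimodular covering; (iii) the complement $\overline{G}$ satisfies the odd cycle condition, i.e., if two odd holes $C_1$ and $C_2$ in $\overline{G}$ have no common vertices, then there exists a bridge of $C_1$ and $C_2$ in $\overline{G}$. In particular, if $\mathcal{Q}_G$ is normal, then the edge polytope $\mathcal{P}_{\overline{G}}$ is normal.
   Context: $G$ is a graph on the vertex set $[n]=\{1,\dots,n\}$ with edge set $E(G)$, and $\overline{G}$ is its complement. A subset $W\subset[n]$ is stable if no two distinct elements of $W$ form an edge of $G$ (the empty set and singletons are stable); $S(G)$ is the set of stable sets, and the stability number $\alpha(G)$ is the largest cardinality of a stable set. With $\mathbf{e}_i$ the unit coordinate vectors of $\mathbb{R}^n$ and $\rho(W)=\sum_{j\in W}\mathbf{e}_j$, the stable set polytope $\mathcal{Q}_G\subset\mathbb{R}^n$ is the convex hull of $\{\rho(W): W\in S(G)\}$. The edge polytope $\mathcal{P}_H\subset\mathbb{R}^n$ of a simple graph $H$ on $[n]$ is the convex hull of $\{\mathbf{e}_i+\mathbf{e}_j:\{i,j\}\in E(H)\}$. Let $K$ be a field. For an integral convex polytope $\mathcal{P}\subset\mathbb{R}^n$ with $\mathcal{P}\cap\mathbb{Z}^n=\{\mathbf{a}_1,\dots,\mathbf{a}_m\}$, the toric ring $K[\mathcal{P}]$ is the $K$-subalgebra of $K[x_1^{\pm1},\dots,x_n^{\pm1},t]$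 generated by $X^{\mathbf{a}_1}t,\dots,X^{\mathbf{a}_m}t$, where $X^{\mathbf{a}}=x_1^{a_1}\cdots x_n^{a_n}$. The polytope $\mathcal{P}$ is called normal if $K[\mathcal{P}]$ is a normal domain. A unimodular covering of $\mathcal{P}$ is a collection of unimodular simplices (with respect to the lattice generated by the lattice points of $\mathcal P$, homogenized by adding a last coordinate $1$) with vertices in $\mathcal{P}\cap\mathbb{Z}^n$ whose union is $\mathcal{P}$. A hole of a graph is an induced cycle of length $>3$; it is odd if its length is odd. If $C_1$ and $C_2$ are cycles in a graph, a bridge of $C_1$ and $C_2$ is an edge $\{i,j\}$ of the graph with $i$ a vertex of $C_1$ not in $C_2$ and $j$ a vertex of $C_2$ not in $C_1$. A graph satisfies the odd cycle condition if, for any two induced odd cycles $C_1$ and $C_2$ in it, either $C_1$ and $C_2$ have a common vertex or there exists a bridge of $C_1$ and $C_2$. *)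

(* Defs.v *)
From HB Require Import structures.
From mathcomp Require Import all_boot all_order all_algebra.
From mathcomp Require Import classical_sets reals.
From mathcomp Require Import mpoly.

Set Implicit Arguments.
Unset Strict Implicit.
Unset Printing Implicit Defensive.

Import Order.TTheory GRing.Theory Num.Theory.

Local Open Scope classical_set_scope.
Local Open Scope ring_scope.

(* A simple graph on n vertices is a symmetric irreflexive relation on 'I_n. *)

Definition compl_rel (T : eqType) (e : rel T) : rel T :=
  [rel x y | (x != y) && ~~ e x y].

Definition stable (T : finType) (e : rel T) (W : {set T}) : bool :=
  [forall x in W, forall y in W, (x != y) ==> ~~ e x y].

Definition stability_number (T : finType) (e : rel T) : nat :=
  \max_(W : {set T} | stable e W) #|W|.

(* A cycle is the cyclic sequence of its (distinct) vertices; it is induced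
   when it has no chord. *)
Definition induced_cycle (T : eqType) (e : rel T) (c : seq T) : Prop :=
  [/\ (3 <= size c)%N, ucycle e c &
      {in c &, forall x y, e x y -> y = next c x \/ x = next c y}].

Definition odd_induced_cycle (T : eqType) (e : rel T) (c : seq T) : Prop :=
  induced_cycle e c /\ odd (size c).

Definition hole (T : eqType) (e : rel T) (c : seq T) : Prop :=
  induced_cycle e c /\ (3 < size c)%N.

Definition odd_hole (T : eqType) (e : rel T) (c : seq T) : Prop :=
  hole e c /\ odd (size c).

Definition common_vertex (T : eqType) (c1 c2 : seq T) : Prop :=
  exists2 x, x \in c1 & x \in c2.

Definition bridge (T : eqType) (e : rel T) (c1 c2 : seq T) (i j : T) : Prop :=
  [/\ e i j, i \in c1, i \notin c2, j \in c2 & j \notin c1].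

Definition has_bridge (T : eqType) (e : rel T) (c1 c2 : seq T) : Prop :=
  exists i j, bridge e c1 c2 i j.

Definition odd_cycle_condition (T : eqType) (e : rel T) : Prop :=
  forall c1 c2, odd_induced_cycle e c1 -> odd_induced_cycle e c2 ->
  common_vertex c1 c2 \/ has_bridge e c1 c2.

Definition convex_hull (R : realType) (n : nat) (X : set 'rV[R]_n) :
    set 'rV[R]_n :=
  [set v | exists m (p : 'I_m -> 'rV[R]_n) (c : 'I_m -> R),
    [/\ forall i, X (p i), forall i, 0 <= c i, \sum_i c i = 1 &
        v = \sum_i c i *: p i]].

Definition rho (R : realType) (n : nat) (W : {set 'I_n}) : 'rV[R]_n :=
  \sum_(j in W) delta_mx 0 j.

Definition stable_set_polytope (R : realType) (n : nat) (e : rel 'I_n) :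
    set 'rV[R]_n :=
  convex_hull [set v | exists2 W : {set 'I_n}, stable e W & v = rho R W].
Arguments stable_set_polytope R {n} e _.

Definition edge_polytope (R : realType) (n : nat) (e : rel 'I_n) :
    set 'rV[R]_n :=
  convex_hull [set v | exists i j : 'I_n,
    e i j /\ v = delta_mx 0 i + delta_mx 0 j].
Arguments edge_polytope R {n} e _.

Definition real_point (R : realType) (n : nat) (a : 'rV[int]_n) : 'rV[R]_n :=
  map_mx intr a.

Definition lattice_points (R : realType) (n : nat) (P : set 'rV[R]_n) :
    set 'rV[int]_n :=
  [set a | P (real_point R a)].

Inductive subalgebra_generated (K : fieldType) (L : fieldType)
    (iota : K -> L) (X : set L) : L -> Prop :=
| subalg_scalar c : subalgebra_generated iota X (iota c)
| subalg_gen x of X x : subalgebra_generated iota X x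
| subalg_add x y of subalgebra_generated iota X x &
    subalgebra_generated iota X y : subalgebra_generated iota X (x + y)
| subalg_mul x y of subalgebra_generated iota X x &
    subalgebra_generated iota X y : subalgebra_generated iota X (x * y).

Definition integral_over (L : fieldType) (S : set L) (u : L) : Prop :=
  exists p : {poly L}, [/\ p \is monic, forall i, S p`_i & root p u].

(* For a subring S of a field L, S is a domain and its field of fractions is
   the set of quotients f / g in L. *)
Definition normal_domain (L : fieldType) (S : set L) : Prop :=
  forall f g, S f -> S g -> g != 0 -> integral_over S (f / g) -> S (f / g).

(* The Laurent polynomial ring K[x_1^{+-1}, ..., x_n^{+-1}, t] is viewed inside
   the field of rational functions in n + 1 variables, the last one being t. *)
Definition ratfun (K : fieldType) (n : nat) : fieldType :=
  {fraction {mpoly K[n.+1]}}.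

Definition ratfun_const (K : fieldType) (n : nat) (c : K) : ratfun K n :=
  tofrac (c%:MP_[n.+1]).

Definition ratfun_x (K : fieldType) (n : nat) (i : 'I_n) : ratfun K n :=
  tofrac ('X_(widen_ord (leqnSn n) i) : {mpoly K[n.+1]}).

Definition ratfun_t (K : fieldType) (n : nat) : ratfun K n :=
  tofrac ('X_(@ord_max n) : {mpoly K[n.+1]}).

Definition laurent_monomial (K : fieldType) (n : nat) (a : 'rV[int]_n) :
    ratfun K n :=
  \prod_(i < n) ratfun_x K i ^ a 0 i.

Definition toric_ring (K : fieldType) (R : realType) (n : nat)
    (P : set 'rV[R]_n) : set (ratfun K n) :=
  subalgebra_generated (@ratfun_const K n)
    [set f | exists2 a, lattice_points P a &
       f = laurent_monomial K a * ratfun_t K n].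
Arguments toric_ring K {R n} P _.

Definition normal_polytope (K : fieldType) (R : realType) (n : nat)
    (P : set 'rV[R]_n) : Prop :=
  normal_domain (toric_ring K P).

Definition homogenize (n : nat) (a : 'rV[int]_n) : 'rV[int]_(n + 1) :=
  row_mx a 1%:M.

Definition int_span (N : nat) (X : set 'rV[int]_N) : set 'rV[int]_N :=
  [set w | exists m (p : 'I_m -> 'rV[int]_N) (c : 'I_m -> int),
    (forall i, X (p i)) /\ w = \sum_i c i *: p i].

Definition polytope_lattice (R : realType) (n : nat) (P : set 'rV[R]_n) :
    set 'rV[int]_(n + 1) :=
  int_span [set homogenize a | a in lattice_points P].

(* A simplex is given by the sequence F of its vertices.  It is unimodular when
   its homogenized vertices form a Z-basis of the lattice of P; independence
   of these is affine independence of the vertices. *)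
Definition unimodular_simplex (R : realType) (n : nat) (P : set 'rV[R]_n)
    (F : seq 'rV[int]_n) : Prop :=
  [/\ forall a, a \in F -> lattice_points P a,
      forall c : 'I_(size F) -> int,
        \sum_i c i *: homogenize F`_i = 0 -> forall i, c i = 0 &
      forall w, polytope_lattice P w ->
        exists c : 'I_(size F) -> int, w = \sum_i c i *: homogenize F`_i].

Definition simplex_hull (R : realType) (n : nat) (F : seq 'rV[int]_n) :
    set 'rV[R]_n :=
  convex_hull [set real_point R a | a in [set b | b \in F]].
Arguments simplex_hull R {n} F _.

Definition unimodular_covering (R : realType) (n : nat) (P : set 'rV[R]_n)
    (C : set (seq 'rV[int]_n)) : Prop :=
  (forall F, C F -> unimodular_simplex P F) /\
  \bigcup_(F in C) simplex_hull R F = P.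

Definition has_unimodular_covering (R : realType) (n : nat)
    (P : set 'rV[R]_n) : Prop :=
  exists C, unimodular_covering P C.

(* Main.v *)
(** The complement [h] of [G] is triangle-free, so the homogenised points of the
    stable set polytope are the edge vectors of the cone over [h], with a loop
    at the apex: writing [e*_i = (delta_i, 1/2)] and [e*_None = (0, 1/2)], they
    are the sums [e*_u + e*_v] over the edges [uv] of that graph.

    Odd cycle condition => unimodular covering.  Among the bases of edge vectors
    whose cone contains a given point, take one with minimal determinant.  If
    two vertices lie in different components of the graph of the basis, each
    component contains an odd cycle (otherwise an alternating sign functional
    kills the basis).  An edge joining these two cycles has all its coordinates
    in the basis at most 1/2, so exchanging it for a basis vector decreases the
    determinant.  Hence that graph is connected, and then the inverse of the
    basis matrix is integral.

    Covering => normality.  Coordinates in a unimodular simplex are integral, so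
    the exponent monoid [A] is saturated.  If [f / g] is integral over the toric
    ring, then [c * f ^ k / g ^ k] lies in it for a fixed [c != 0] and all [k].
    Dickson's lemma applied to the leading monomials puts some multiple of
    [lm f - lm g], hence [lm f - lm g] itself, in [A]; subtract the
    corresponding term and induct on the leading monomial of [f].

    Normality => odd cycle condition.  If [C1] and [C2] are disjoint and not
    bridged, the monomial with exponent the indicator of [C1 + C2] is integral
    but not in the ring, since [C1] would have to be perfectly matched. *)
From mathcomp Require Import mpoly.
Require Import Defs.
From mathcomp Require Import all_boot all_order all_algebra.
From mathcomp Require Import zify ring lra.
From mathcomp Require Import classical_sets reals boolp.

Set Implicit Arguments.
Unset Strict Implicit.
Unset Printing Implicit Defensive.

Import Order.TTheory GRing.Theory Num.Theory.

(** * Odd closed walks and induced odd cycles *)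

Section OddCycles.
Variables (T : finType) (e : rel T).
Hypotheses (e_sym : symmetric e) (e_irr : irreflexive e).

(** A chord cuts a closed walk into two whose lengths add up to [size w + 2], a repeated vertex into
    two whose lengths add up to [size w]; as [size w] is odd, one of the two is odd. *)
Lemma split_odd_cycle w x p y q i :
  rot i w = x :: p ++ y :: q -> cycle e w -> odd (size w) ->
  (e x y || (x == y)) ->
  exists2 w', cycle e w' & odd (size w') /\
    (size w' <= (if x == y then size p else (size p).+1).+1 \/
     size w' <= (if x == y then size q else (size q).+1).+1)%N.
Proof.
move=> Ew; rewrite -(rot_cycle i) -(size_rot i w) Ew /= rcons_cat cat_path /=.
case/and3P=> xp; rewrite rcons_path => lxy /andP[yq lqx] odd_w exy.
have [eq_xy|neq_xy] := eqVneq x y.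
  subst y; move: odd_w; rewrite size_cat /= addnS /= negbK oddD.
  case: (boolP (odd (size p))) => [odd_p /= even_q|even_p _].
    by exists (x :: q); rewrite /= ?rcons_path ?yq ?lqx //; split => //; right.
  by exists (x :: p); rewrite /= ?rcons_path ?xp ?lxy //; split => //; left.
rewrite (negbTE neq_xy) orbF in exy.
move: odd_w; rewrite size_cat /= addnS /= negbK oddD.
case: (boolP (odd (size p))) => [odd_p /= even_q|even_p /= odd_q].
  exists (x :: rcons p y); last by rewrite /= size_rcons /= negbK; split => //; left.
  by rewrite /= !rcons_path last_rcons xp lxy e_sym.
exists (y :: rcons q x); last by rewrite /= size_rcons /= negbK; split => //; right.
by rewrite /= !rcons_path last_rcons yq lqx.
Qed.

Lemma shortest_odd_closed_walk w :
  cycle e w -> odd (size w) ->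
  (forall w', cycle e w' -> odd (size w') -> (size w <= size w')%N) ->
  odd_induced_cycle e w.
Proof.
move=> cyc_w odd_w min_w.
have size_w : (3 <= size w)%N.
  by case: w cyc_w odd_w {min_w} => [|x [|y [|z w]]] //=; rewrite e_irr.
have uniq_w : uniq w.
  apply/negPn/negP=> nUw.
  have [x [p [q [i Ew]]]] : exists x p q i, rot i w = x :: p ++ x :: q.
    case: w nUw {cyc_w odd_w min_w size_w} => // x0 w0; set w := _ :: _.
    case/(uniqPn x0) => i [j [lt_ij lt_jw eq_ij]].
    set x := nth x0 w i; have x_w : x \in drop i.+1 w.
      rewrite /x eq_ij -(subnKC lt_ij) -nth_drop mem_nth //.
      by rewrite size_drop ltn_sub2r // (leq_ltn_trans lt_ij).
    case/splitPr: x_w (drop_nth x0 (ltn_trans lt_ij lt_jw)) => p q Ed.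
    by exists x, p, (q ++ take i w), i; rewrite /rot Ed /= -catA.
  have [|w' cyc' [odd' sz']] := split_odd_cycle Ew cyc_w odd_w.
    by rewrite eqxx orbT.
  have := min_w _ cyc' odd'.
  by rewrite -(size_rot i w) Ew /= size_cat /=; rewrite eqxx in sz'; lia.
split=> //; split=> //; first by rewrite /ucycle cyc_w uniq_w.
move=> x y x_w y_w exy.
have neq_xy : x != y by apply: contraTneq exy => ->; rewrite e_irr.
have [i w1 Ew] := rot_to x_w.
have y_w1 : y \in w1.
  by move: y_w; rewrite -(mem_rot i) Ew inE eq_sym (negbTE neq_xy).
case/splitPr: y_w1 Ew => p q Ew.
have [|w' cyc' [odd' sz']] := split_odd_cycle Ew cyc_w odd_w.
  by rewrite exy.
have := min_w _ cyc' odd'.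
rewrite (negbTE neq_xy) in sz'.
rewrite -(size_rot i w) Ew /= size_cat /= => lew.
have rot_uniq : uniq (x :: p ++ y :: q) by rewrite -Ew rot_uniq.
rewrite -(next_rot i uniq_w x) -(next_rot i uniq_w y) Ew.
(* Minimality of [w] forces the arc that [w'] leaves out to be empty, so the chord is an edge of the
   cycle. *)
case: sz' => /(leq_trans lew) le_pq.
  have q0 : q = [::] by apply: size0nil; move: le_pq; move: (size q) => k; lia.
  subst q; right; rewrite -(next_rot (size p).+1 rot_uniq).
  by rewrite -[(size p).+1]/(size (x :: p)) -cat_cons rot_size_cat /= eqxx.
have p0 : p = [::] by apply: size0nil; move: le_pq; move: (size p) => k; lia.
by subst p; left; rewrite /= eqxx.
Qed.

Hypothesis no_coloring : forall s : T -> bool, exists x y, e x y /\ s x = s y.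

(* In the bipartite double cover an odd closed walk at [x] becomes a path from
   [(x, false)] to [(x, true)]. *)
Let cover : rel (T * bool) := [rel p q | e p.1 q.1 && (p.2 != q.2)].

Let cover_path_proj p x b :
  path cover (x, b) p ->
  path e x (map fst p) /\ (last (x, b) p).2 = b (+) odd (size p).
Proof.
elim: p x b => [|[y c] p IHp] x b /=; first by rewrite addbF.
case/andP=> /andP[/= exy neq_bc] /IHp[-> ->]; rewrite exy; split => //.
by case: b c neq_bc (odd _) => [] [] // _ [].
Qed.

(** If no vertex had its two lifts connected in the double cover, colouring [x] by whether
    [(x, true)] is reached from the root of its component would be proper. *)
Lemma odd_closed_walk_exists : exists2 w, cycle e w & odd (size w).
Proof.
have cover_sym : connect_sym cover.
  by apply: sym_connect_sym => p q; rewrite /cover /= e_sym eq_sym.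
have [/existsP[x /connectP[p x_p Ep]]|no_odd] :=
    boolP [exists x, connect cover (x, false) (x, true)].
  have [ep odd_p] := cover_path_proj x_p.
  exists (map fst p); last by move: odd_p; rewrite -Ep /= size_map => <-.
  have last_p : last x (map fst p) = x by rewrite (last_map fst p (x, false)) -Ep.
  by rewrite (cycle_path x) last_p.
pose r x := (fingraph.root e x, false).
pose s x := connect cover (r x) (x, true).
have [x [y [exy sxy]]] := no_coloring s.
have e_conn := sym_connect_sym e_sym.
have rxy : r x = r y.
  by rewrite /r; congr (_, _); by apply/eqP; rewrite root_connect //; apply: connect1.
have [b r_x] : exists b, connect cover (r x) (x, b).
  have: connect e (fingraph.root e x) x by rewrite e_conn connect_root.
  case/connectP=> p; rewrite /r; elim: p (fingraph.root e x) false => [|z p IHp] u c /=.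
    by move=> _ ->; exists c; apply: connect0.
  case/andP=> euz /IHp/[apply]/(_ (~~ c)) [b z_x]; exists b.
  by apply: connect_trans z_x; apply: connect1; rewrite /cover /= euz; case: c.
have xy c : connect cover (x, c) (y, ~~ c).
  by apply: connect1; rewrite /cover /= exy; case: c.
move: sxy; rewrite /s -rxy.
have [r_xt /esym r_yt|r_xf /esym r_yf] := boolP (connect _ _ (x, true)).
  case/existsP: no_odd; exists y; apply: connect_trans r_yt.
  by rewrite cover_sym; apply: connect_trans r_xt (xy true).
case: b r_x => r_x; first by rewrite r_x in r_xf.
by rewrite (connect_trans r_x (xy false)) in r_yf.
Qed.

End OddCycles.

(** A shortest odd closed walk of the subgraph on [U] is induced there, hence in [e], since any
    chord has both ends in [U]. *)
Lemma two_coloring_or_odd_induced_cycle (T : finType) (e : rel T) (U : pred T) :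
  symmetric e -> irreflexive e ->
  (exists s : T -> bool, {in U &, forall x y, e x y -> s x != s y}) \/
  (exists2 c, odd_induced_cycle e c & {subset c <= U}).
Proof.
move=> e_sym e_irr; set eU : rel T := [rel x y | [&& e x y, x \in U & y \in U]].
have eU_sym : symmetric eU by move=> x y; rewrite /eU /= e_sym [(x \in U) && _]andbC.
have eU_irr : irreflexive eU by move=> x; rewrite /eU /= e_irr.
have [|no_col] := pselect (exists s : T -> bool, forall x y, eU x y -> s x != s y).
  by case=> s sP; left; exists s => x y xU yU exy; apply: sP; rewrite /eU /= exy xU.
right.
have [|w0 cyc0 odd0] := odd_closed_walk_exists eU_sym.
  move=> s; apply: contrapT => ns; apply: no_col; exists s => x y exy.
  by apply/eqP => sxy; apply: ns; exists x, y.
have ex_w : exists k, `[< exists w, [/\ cycle eU w, odd (size w) & size w = k] >].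
  by exists (size w0); apply/asboolP; exists w0.
case: (ex_minnP ex_w) => k /asboolP[w [cyc_w odd_w size_w]] min_w.
have ind_w : odd_induced_cycle eU w.
  apply: shortest_odd_closed_walk => // w' cyc_w' odd_w'; rewrite size_w.
  by apply: min_w; apply/asboolP; exists w'.
have wU : {subset w <= U} by move=> x /(next_cycle cyc_w)/and3P[].
exists w => //; case: ind_w => -[sz /andP[_ uw] ind] _; split=> //; split=> //.
  apply/andP; split=> //; apply: sub_cycle cyc_w => //.
  by move=> x y /and3P[].
by move=> x y x_w y_w exy; apply: ind => //; rewrite /eU /= exy !wU.
Qed.

Local Open Scope ring_scope.

(** * Basis exchange *)

Section Exchange.
Variables (R : realFieldType) (N : nat).
Implicit Types (M : 'M[R]_N) (b l : 'rV[R]_N) (k : 'I_N).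

(** The ratio test of the simplex method: moving along [- b] stops at the first coordinate to
    vanish, and coordinates with [b 0 i <= 0] never decrease. *)
Lemma min_ratio l b :
  (forall i, 0 <= l 0 i) -> (exists i, 0 < b 0 i) ->
  exists k, 0 < b 0 k /\ forall i, 0 <= l 0 i - l 0 k / b 0 k * b 0 i.
Proof.
move=> l_ge0 [i0 bi0].
have [k bk min_k] :=
  @arg_minP _ R _ i0 (fun i => 0 < b 0 i) (fun i => l 0 i / b 0 i) bi0.
exists k; split=> // i; have [bi|bi] := ltP 0 (b 0 i).
  by rewrite subr_ge0 -ler_pdivlMr // min_k.
rewrite subr_ge0 (le_trans _ (l_ge0 i)) // mulr_ge0_le0 //.
by rewrite divr_ge0 // ltW.
Qed.

Definition row_exchange M k (r : 'rV[R]_N) : 'M[R]_N :=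
  \matrix_i (if i == k then r else row i M).

Lemma row_exchangeE M k b :
  row_exchange M k (b *m M) = row_exchange 1%:M k b *m M.
Proof.
apply/row_matrixP => i; rewrite row_mul !rowK; case: eqP => // _.
by rewrite row1 rowE.
Qed.

(** Cramer's rule: in the coordinates of [M], the exchanged matrix is the identity with row [k]
    replaced by [b]. *)
Lemma det_row_exchange M k b :
  \det (row_exchange M k (b *m M)) = b 0 k * \det M.
Proof.
rewrite row_exchangeE det_mulmx; congr (_ * _).
rewrite (expand_det_col _ k) (bigD1 k) //= big1 => [|i neq_ik]; last first.
  by rewrite !mxE (negbTE neq_ik) !mxE (negbTE neq_ik) mul0r.
rewrite addr0 !mxE eqxx /cofactor -signr_odd addnn odd_double mul1r.
rewrite (_ : row' k _ = 1%:M) ?det1 ?mulr1 //.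
apply/matrixP=> i j; rewrite !mxE eq_sym (negbTE (neq_lift _ _)) !mxE.
by rewrite (inj_eq lift_inj).
Qed.

Lemma mul_row_exchange M k l b s :
  l 0 k = s * b 0 k ->
  l *m M = (\row_i (if i == k then s else l 0 i - s * b 0 i)) *m
           row_exchange M k (b *m M).
Proof.
move=> lk; rewrite row_exchangeE mulmxA; congr (_ *m _).
apply/rowP=> j; rewrite !mxE (bigD1 k) //= !mxE eqxx.
have [->|neq_jk] := eqVneq j k.
  rewrite big1 ?addr0 // => i neq_ik; rewrite !mxE (negbTE neq_ik) !mxE (negbTE neq_ik).
  by rewrite mulr0.
rewrite (bigD1 j) //= !mxE (negbTE neq_jk) !mxE eqxx mulr1 big1 ?addr0 => [|i].
  by rewrite addrC subrK.
case/andP=> neq_ik neq_ij; rewrite !mxE (negbTE neq_ik) !mxE (negbTE neq_ij).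
by rewrite mulr0.
Qed.

End Exchange.

Lemma fpath_alternating (T : eqType) (R : pzRingType) (f : T -> T) (z : T -> R) y s :
  fpath f y s -> {in belast y s, forall u, z (f u) = - z u} ->
  z (last y s) = (-1) ^+ size s * z y /\
  {in y :: s, forall u, z u = z y \/ z u = - z y}.
Proof.
elim: s y => [|x s IHs] y /=.
  by move=> _ _; rewrite mul1r; split=> // u; rewrite inE => /eqP->; left.
case/andP=> /eqP<- ys zN; have zfy : z (f y) = - z y by apply: zN; rewrite inE eqxx.
have [|-> zs] := IHs _ ys; first by move=> u su; apply: zN; rewrite inE su orbT.
split=> [|u]; first by rewrite zfy exprS mulN1r mulrN mulNr.
rewrite inE => /orP[/eqP->|/zs]; first by left.
by rewrite zfy opprK => -[]; [right|left].
Qed.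

(** From [next c x0] round to [x0] the sign changes an even number of times, so these two values
    agree and each is [d / 2]. *)
Lemma odd_cycle_alternating (T : eqType) (R : realFieldType) (z : T -> R) c x0 d :
  uniq c -> odd (size c) -> x0 \in c ->
  z x0 + z (next c x0) = d ->
  {in c, forall x, x != x0 -> z (next c x) = - z x} ->
  {in c, forall x, z x = d / 2 \/ z x = - (d / 2)}.
Proof.
move=> Uc odd_c x0c zd zN x xc.
have [i p Ec] := rot_to x0c.
have := cycle_next Uc; rewrite -(rot_cycle i) Ec /=.
have Up : uniq (x0 :: p) by rewrite -Ec rot_uniq.
have odd_p : ~~ odd (size p) by move: odd_c; rewrite -(size_rot i) Ec.
have xp : x \in x0 :: p by rewrite -Ec mem_rot.
have mem_c u : u \in x0 :: p -> u \in c by rewrite -Ec mem_rot.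
case: p Ec Up odd_p xp mem_c => [|y q] Ec Up odd_p xp mem_c /=.
  rewrite andbT => /eqP nx; move: xp; rewrite inE => /eqP->; left.
  by rewrite -zd nx; field.
case/andP=> /eqP nx0 yq.
have [|z_last z_all] := fpath_alternating yq (z := z).
  rewrite belast_rcons => u u_yq; apply: zN; first by rewrite mem_c // inE u_yq orbT.
  by case/andP: Up => /negP x0_yq _; apply/eqP=> ux; rewrite ux in u_yq.
move: z_last; rewrite last_rcons size_rcons -signr_odd /=.
rewrite (_ : odd (size q) = true) /= ?expr0 ?mul1r => [z0y|]; last first.
  by move: odd_p => /=; rewrite negbK.
have zy : z y = d / 2 by rewrite -zd nx0 z0y; field.
rewrite -zy; apply: z_all; move: xp; rewrite !inE mem_rcons inE.
by case/or3P=> ->; rewrite ?orbT.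
Qed.

Lemma odd_size_mem (T : eqType) (c : seq T) : odd (size c) -> exists x, x \in c.
Proof. by case: c => // x c; exists x; rewrite inE eqxx. Qed.

Lemma odd_cycle_not_two_colored (T : eqType) (s : T -> bool) c :
  cycle (fun x y => s x != s y) c -> ~~ odd (size c).
Proof.
case: c => // x c /=.
have s_last p y : path (fun x y => s x != s y) y p -> s (last y p) = s y (+) odd (size p).
  elim: p y => [|u p IHp] y /=; first by rewrite addbF.
  by case/andP=> neq /IHp->; case: (s y) (s u) neq (odd _) => [] [] // _ [].
move/s_last; rewrite last_rcons size_rcons /= => /eqP.
by case: (s x) (odd _) => [] [].
Qed.

(** * Edge vectors of the cone graph *)

Section ConeGraph.
Variables (R : realType) (n : nat) (h : rel 'I_n).
Hypotheses (h_sym : symmetric h) (h_irr : irreflexive h).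
Local Notation V := (option 'I_n).

(* [None] is the apex of the cone: it is adjacent to every vertex and to itself. *)
Definition cone_adj (u v : V) : bool :=
  if (u, v) is (Some i, Some j) then h i j else true.

Definition vertex_row (u : V) : 'rV[R]_(n + 1) :=
  row_mx (if u is Some i then delta_mx 0 i else 0) (2^-1)%:M.

Definition edge_row (uv : V * V) : 'rV[R]_(n + 1) :=
  vertex_row uv.1 + vertex_row uv.2.

Definition edge_point (uv : V * V) : 'rV[int]_n :=
  let d u := if u is Some i then delta_mx 0 i else 0 in d uv.1 + d uv.2.

Lemma map_homogenize_edge_point uv :
  map_mx intr (homogenize (edge_point uv)) = edge_row uv.
Proof.
rewrite /homogenize map_row_mx /edge_row /vertex_row add_row_mx; congr row_mx.
  rewrite map_mxD; congr (_ + _).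
    by case: uv.1 => [i|]; rewrite ?map_delta_mx ?map_mx0.
  by case: uv.2 => [i|]; rewrite ?map_delta_mx ?map_mx0.
by rewrite map_mx1 -raddfD; congr (_ %:M); field.
Qed.

(* [F] is a candidate basis; [vertex_coord f u] below is the coordinate of
   [vertex_row u] along the basis vector [edge_row (F f)]. *)
Variable F : 'I_(n + 1) -> V * V.
Hypothesis F_adj : forall k, cone_adj (F k).1 (F k).2.

Definition edge_mx : 'M[R]_(n + 1) := \matrix_k edge_row (F k).
Definition edge_imx : 'M[int]_(n + 1) := \matrix_k homogenize (edge_point (F k)).

Lemma map_edge_imx : map_mx intr edge_imx = edge_mx.
Proof. by apply/row_matrixP=> k; rewrite -map_row !rowK map_homogenize_edge_point. Qed.

Lemma det_edge_mx : \det edge_mx = (\det edge_imx)%:~R.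
Proof. by rewrite -map_edge_imx det_map_mx. Qed.

Hypothesis F_free : edge_mx \in unitmx.

Definition vertex_coord (f : 'I_(n + 1)) (u : V) : R :=
  (vertex_row u *m invmx edge_mx) 0 f.
Local Notation z := vertex_coord.

Lemma vertex_coordD f uv : z f uv.1 + z f uv.2 = (edge_row uv *m invmx edge_mx) 0 f.
Proof. by rewrite /edge_row mulmxDl [RHS]mxE. Qed.

Lemma vertex_coord_edge k f : z f (F k).1 + z f (F k).2 = (k == f)%:R.
Proof.
rewrite vertex_coordD -(rowK _ k : row k edge_mx = _) -row_mul mulmxV // row1 mxE eqxx.
by rewrite eq_sym.
Qed.

Definition support_graph : rel V :=
  [rel u v | [exists k, (F k == (u, v)) || (F k == (v, u))]].
Local Notation g := support_graph.

Lemma support_graph_sym : symmetric g.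
Proof. by move=> u v; apply: eq_existsb => k; rewrite orbC. Qed.

Lemma support_graph_adj u v : g u v -> cone_adj u v.
Proof.
case/existsP=> k /orP[] /eqP Fk; have := F_adj k; rewrite Fk //=.
by case: u v {Fk} => [i|] [j|]; rewrite /cone_adj /= 1?h_sym.
Qed.

(** Two indices carrying the same edge would give equal rows in an invertible matrix, so an edge
    determines its index, up to orientation. *)
Lemma coord_support_graph f u v :
  g u v -> z f u + z f v = ((F f == (u, v)) || (F f == (v, u)))%:R.
Proof.
case/existsP=> k Fk.
have -> : z f u + z f v = (k == f)%:R.
  by case/orP: Fk => /eqP Fk; rewrite -vertex_coord_edge Fk //= addrC.
have [<-|neq_kf] := eqVneq k f; first by rewrite Fk.
case: orP => // Ff; exfalso.
have zz : edge_row (F k) = edge_row (F f).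
  by case/orP: Fk => /eqP ->; case: Ff => /eqP ->; rewrite /edge_row //= addrC.
have := vertex_coord_edge f f; have := vertex_coord_edge k f.
rewrite (negbTE neq_kf) eqxx !vertex_coordD zz => -> /eqP.
by rewrite eq_sym oner_eq0.
Qed.

Lemma odd_cycle_coord c f :
  ucycle g c -> odd (size c) ->
  exists2 d : R, {in c, forall u, z f u = d / 2 \/ z f u = - (d / 2)} &
    d = 0 \/ [/\ d = 1, (F f).1 \in c & (F f).2 \in c].
Proof.
case/andP=> cyc_c Uc odd_c.
have edge_c u : u \in c -> g u (next c u) by apply: next_cycle.
pose at_f u := (F f == (u, next c u)) || (F f == (next c u, u)).
have [/hasP[x0 x0c Fx0]|/hasPn no_f] := boolP (has at_f c).
  exists 1; last first.
    by right; split=> //; case/orP: Fx0 => /eqP->; rewrite //= mem_next.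
  apply: (odd_cycle_alternating Uc odd_c x0c).
    by rewrite coord_support_graph ?edge_c // -/(at_f x0) Fx0.
  move=> x xc neq_x; apply/eqP; rewrite -addr_eq0 addrC.
  rewrite coord_support_graph ?edge_c // -/(at_f x).
  suff -> : at_f x = false by [].
  apply/negP => Fx.
  (* Meeting the edge [F f] from two places would make the cycle have length two, against parity. *)
  have [xE x0E] : x = next c x0 /\ x0 = next c x.
    move: Fx Fx0; rewrite /at_f.
    by case/orP=> /eqP-> /orP[] => /eqP; case=> e1 e2; split=> //;
      move: neq_x; rewrite ?e1 ?e2 ?eqxx.
  have [i p Ec] := rot_to x0c.
  have Up : uniq (x0 :: p) by rewrite -Ec rot_uniq.
  move: odd_c; rewrite -(size_rot i) Ec.
  have nx u : next c u = next (x0 :: p) u by rewrite -(next_rot i Uc) Ec.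
  rewrite !nx in xE x0E; case: p Up {Ec nx} xE x0E => [|y [|w q]] Up xE x0E //= _.
    by rewrite xE /= !eqxx in neq_x.
  move: Up xE x0E => /=.
  rewrite eqxx !inE => /andP[/norP[/negPf x0y /norP[/negPf x0w _]] _] ->.
  by rewrite eq_sym x0y eqxx => x0w'; rewrite x0w' eqxx in x0w.
have [x0 x0c] := odd_size_mem odd_c.
have zN x : x \in c -> z f x + z f (next c x) = 0.
  by move=> xc; rewrite coord_support_graph ?edge_c // -/(at_f x) (negbTE (no_f _ xc)).
exists 0; last by left.
apply: (odd_cycle_alternating Uc odd_c x0c); first exact: zN.
by move=> x xc _; apply/eqP; rewrite -addr_eq0 addrC zN.
Qed.

(* Otherwise a proper 2-colouring of the component, read as a vector of signs,
   is orthogonal to all rows of [edge_mx]. *)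
Lemma component_odd_cycle r :
  exists c, [/\ ucycle g c, odd (size c) & {subset c <= connect g r}].
Proof.
(* A loop at the apex is itself an odd cycle, of length one. Once it is set aside, the component has
   no loop. *)
have [/andP[gNN rN]|no_loop] := boolP (g None None && connect g r None).
  exists [:: None]; split=> //=; first by rewrite /ucycle /= gNN.
  by move=> u; rewrite inE => /eqP->.
pose g' : rel V := [rel u v | g u v && (u != v)].
have g'_sym : symmetric g' by move=> u v; rewrite /g' /= support_graph_sym eq_sym.
have g'_irr : irreflexive g' by move=> u; rewrite /g' /= eqxx andbF.
have [[s sP]|[c [[_ cyc_c _] odd_c] c_sub]] :=
  two_coloring_or_odd_induced_cycle (connect g r) g'_sym g'_irr; last first.
  exists c; split=> //; case/andP: cyc_c => cyc_c uc; rewrite /ucycle uc andbT.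
  by apply: sub_cycle cyc_c => u v /andP[].
pose eps u : R := if connect g r u then (-1) ^+ s u else 0.
(* The last entry is [2 * eps None] because of the 1/2 in [vertex_row], and the other entries are
   corrected by [eps None], so that [vertex_row u *m w] is [eps u]. *)
pose w : 'cV[R]_(n + 1) :=
  col_mx (\col_i (eps (Some i) - eps None)) (eps None *+ 2)%:M.
have vw u : vertex_row u *m w = (eps u)%:M.
  rewrite mul_row_col -scalar_mxM mulr2n.
  have -> : 2^-1 * (eps None + eps None) = eps None by field.
  case: u => [i|]; last by rewrite mul0mx add0r.
  by rewrite -rowE [row i _]mx11_scalar -raddfD !mxE subrK.
have Mw : edge_mx *m w = 0.
  apply/row_matrixP=> k; rewrite row_mul rowK row0 /edge_row mulmxDl !vw -raddfD.
  have : g (F k).1 (F k).2 by apply/existsP; exists k; rewrite -surjective_pairing eqxx.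
  move: (F k).1 (F k).2 => u v guv; rewrite /eps.
  have <- : connect g r u = connect g r v.
    by apply: (same_connect1r (sym_connect_sym support_graph_sym)).
  case: ifP => [ru|_]; last by rewrite addr0 raddf0.
  have neq_uv : u != v.
    apply/eqP=> uv; subst v; case: u guv ru => [i|] guv ru.
      by have := support_graph_adj guv; rewrite /cone_adj h_irr.
    by rewrite guv ru in no_loop.
  have: s u != s v.
    have rv : connect g r v.
      by rewrite -(same_connect1r (sym_connect_sym support_graph_sym) guv).
    by apply: (sP u v); [exact: ru | exact: rv | rewrite /g' /= guv].
  by case: (s u) (s v) => [] [] // _; rewrite ?expr0 ?expr1 ?subrr ?addNr raddf0.
have w0 : w = 0 by rewrite -(mulKmx F_free w) Mw mulmx0.
have := congr1 (fun A : 'M_1 => A 0 0) (vw r); rewrite w0 mulmx0 !mxE /= mulr1n.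
by rewrite /eps connect0 => /esym/eqP; rewrite signr_eq0.
Qed.

Let g_conn := sym_connect_sym support_graph_sym.

(** On the odd cycle of the component the coordinate is 0, 1/2 or -1/2. Sums along edges are
    integers, which carries half-integrality to the whole component. *)
Lemma double_vertex_coord_int f u : 2 * z f u \is a Num.int.
Proof.
have [c [cyc_c odd_c c_sub]] := component_odd_cycle u.
have [x xc] := odd_size_mem odd_c.
have zx : 2 * z f x \is a Num.int.
  have [d dP d01] := odd_cycle_coord f cyc_c odd_c.
  have dint : d \is a Num.int by case: d01 => [->|[-> _ _]]; rewrite ?rpred0 ?rpred1.
  by case: (dP x xc) => ->; rewrite ?mulrN ?rpredN mulrC divfK ?pnatr_eq0.
have cl : closed g [pred v | 2 * z f v \is a Num.int].
  apply: (intro_closed g_conn) => v w gvw; rewrite !inE => zv.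
  have -> : 2 * z f w = 2 * (z f v + z f w) - 2 * z f v by ring.
  by rewrite coord_support_graph // rpredB // rpredM ?rpred_nat.
have := closed_connect cl (c_sub x xc : connect g u x); rewrite !inE => ->.
exact: zx.
Qed.

Lemma connected_coord_int f u v : connect g u v -> z f u + z f v \is a Num.int.
Proof.
move=> uv; have cl : closed g [pred w | z f u + z f w \is a Num.int].
  apply: (intro_closed g_conn) => w w' gww'; rewrite !inE => zw.
  have -> : z f u + z f w' = (z f u + z f w) + (z f w + z f w') - 2 * z f w by ring.
  by rewrite rpredB ?double_vertex_coord_int // rpredD // coord_support_graph // rpred_nat.
have := closed_connect cl uv; rewrite !inE => <-.
by rewrite -mulr2n -mulr_natl double_vertex_coord_int.
Qed.

(** The unit vectors are integral combinations of the edge vectors of [(i, None)] and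
    [(None, None)], whose coordinates connectedness makes integral. *)
Lemma det_connected :
  (forall u v, connect g u v) -> absz (\det edge_imx) = 1%N.
Proof.
move=> conn.
have inv_int i f : invmx edge_mx i f \is a Num.int.
  have -> : invmx edge_mx i f = ((delta_mx 0 i : 'rV_(n + 1)) *m invmx edge_mx) 0 f.
    by rewrite -rowE mxE.
  case: (split_ordP i) => j ->.
    have -> : delta_mx 0 (lshift 1 j) = edge_row (Some j, None) - edge_row (None, None).
      rewrite /edge_row opprD addrACA subrr addr0 delta_mx_lshift.
      by rewrite opp_row_mx add_row_mx subr0 subrr.
    rewrite mulmxBl mxE [X in _ + X]mxE -!vertex_coordD.
    by apply: rpredB; apply: connected_coord_int.
  have -> : delta_mx 0 (rshift n j) = edge_row (None, None).
    rewrite /edge_row delta_mx_rshift add_row_mx addr0 -raddfD (ord1 j) /=.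
    congr row_mx; rewrite (_ : 2^-1 + 2^-1 = 1); last by field.
    by apply/matrixP => k l; rewrite !ord1 !mxE.
  by rewrite -vertex_coordD; apply: connected_coord_int.
pose B : 'M[int]_(n + 1) := \matrix_(i, f) Num.floor (invmx edge_mx i f).
have BM : (\det B * \det edge_imx)%:~R = 1 :> R.
  rewrite rmorphM /= -det_edge_mx -det_map_mx -det_mulmx.
  rewrite (_ : map_mx _ _ = invmx edge_mx) ?mulVmx ?det1 //.
  by apply/matrixP=> i f; rewrite mxE [B _ _]mxE; apply: floorK.
have /(congr1 absz)/eqP : \det B * \det edge_imx = 1.
  by apply/eqP; rewrite -(eqr_int R) BM.
by rewrite abszM muln_eq1 => /andP[_ /eqP].
Qed.

Lemma reducing_edge :
  odd_cycle_condition h -> absz (\det edge_imx) != 1%N ->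
  exists uv, cone_adj uv.1 uv.2 /\
    forall f, (edge_row uv *m invmx edge_mx) 0 f < 1.
Proof.
move=> occ det_neq1.
have [u [v nuv]] : exists u v, ~~ connect g u v.
  apply: contrapT => conn; case/eqP: det_neq1; apply: det_connected => u v.
  by apply/negPn/negP => uv; apply: conn; exists u, v.
have [c1 [cyc1 odd1 sub1]] := component_odd_cycle u.
have [c2 [cyc2 odd2 sub2]] := component_odd_cycle v.
have disj x : x \in c1 -> x \in c2 -> False.
  move=> /sub1 ux /sub2 vx; case/negP: nuv.
  by apply: (connect_trans ux); rewrite g_conn; apply: vx.
(* The edge [F f] cannot lie on both disjoint cycles, so one of the two values is 0 and the sum is
   at most 1/2. *)
have ltz x y f : x \in c1 -> y \in c2 -> z f x + z f y < 1.
  move=> xc1 yc2.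
  have [d1 /(_ x xc1) d1P D1] := odd_cycle_coord f cyc1 odd1.
  have [d2 /(_ y yc2) d2P D2] := odd_cycle_coord f cyc2 odd2.
  case: D1 D2 d1P d2P => [->|[-> F1 _]] [->|[-> F2 _]];
    by [case: (disj _ F1 F2) | case=> -> [] ->; lra].
suff [x [y [xc1 yc2 adjxy]]] : exists x y, [/\ x \in c1, y \in c2 & cone_adj x y].
  by exists (x, y); split=> // f; rewrite -vertex_coordD; apply: ltz.
have [x xc1] := odd_size_mem odd1; have [y yc2] := odd_size_mem odd2.
have [N1|N1] := boolP (None \in c1); first by exists None, y.
have [N2|N2] := boolP (None \in c2); first by exists x, None; split=> //; case: (x).
(* The cycles of the support graph may have chords in [h]. Away from the apex, such a cycle is an
   odd closed walk of [h], so its vertex set is not two-colourable and contains an induced odd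
   cycle. *)
have hole_in c : ucycle g c -> odd (size c) -> None \notin c ->
    exists2 c', odd_induced_cycle h c' & {subset c' <= [pred i | Some i \in c]}.
  move=> /andP[cyc _] odd_c Nc.
  have [[s sP]|//] := two_coloring_or_odd_induced_cycle [pred i | Some i \in c] h_sym h_irr.
  pose s' u := if u is Some i then s i else false.
  suff /odd_cycle_not_two_colored : cycle (fun x y => s' x != s' y) c by rewrite odd_c.
  apply: (sub_in_cycle (P := mem c)) cyc; last exact/allP.
  move=> [i|] [j|] //= ic jc; rewrite ?(negPf Nc) // in ic jc *.
  by move/support_graph_adj => /= hij; apply: sP.
have [c1' c1'P c1's] := hole_in _ cyc1 odd1 N1.
have [c2' c2'P c2's] := hole_in _ cyc2 odd2 N2.
have [[i /c1's i1 /c2's i2]|[i [j [hij /c1's i1 _ /c2's j2 _]]]] := occ _ _ c1'P c2'P.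
  by case: (disj _ i1 i2).
by exists (Some i), (Some j).
Qed.

End ConeGraph.

(** * Simplicial cones of edge vectors and reduction of their determinant *)

Section UnimodularCone.
Variables (R : realType) (n : nat) (h : rel 'I_n).
Hypotheses (h_sym : symmetric h) (h_irr : irreflexive h).
Local Notation V := (option 'I_n).
Implicit Types (F : 'I_(n + 1) -> V * V) (l y : 'rV[R]_(n + 1)).

Local Notation adj := (fun uv : V * V => cone_adj h uv.1 uv.2).

Let basis_adj F := forall k, adj (F k).

Definition base_edges (k : 'I_(n + 1)) : V * V :=
  if split k is inl i then (Some i, None) else (None, None).

Lemma det_base_edges : \det (edge_imx base_edges) = 1.
Proof.
have -> : edge_imx base_edges = block_mx 1%:M (const_mx 1) 0 1%:M.
  apply/matrixP=> k c; rewrite mxE /homogenize /edge_point /base_edges.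
  case: (split_ordP k) => i ->;
    case: (split_ordP c) => j -> /=.
  - by rewrite row_mxEl block_mxEul addr0 !mxE eq_sym.
  - by rewrite row_mxEr block_mxEur !ord1 !mxE.
  - by rewrite row_mxEl block_mxEdl addr0 !mxE.
  - by rewrite row_mxEr block_mxEdr !ord1 !mxE.
by rewrite det_ublock !det1 mulr1.
Qed.

Lemma edge_mx_exchange F k uv :
  edge_mx R (fun i => if i == k then uv else F i) =
  row_exchange (edge_mx R F) k (edge_row R uv).
Proof. by apply/row_matrixP=> i; rewrite !rowK; case: eqP. Qed.

Lemma edge_mx_unit F : (edge_mx R F \in unitmx) = (\det (edge_imx F) != 0).
Proof. by rewrite unitmxE unitfE det_edge_mx intr_eq0. Qed.

(** All edge vectors have last coordinate 1. In particular an edge vector has a positive coordinate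
    in any basis of edge vectors. *)
Lemma sum_coords_edge uv F : edge_mx R F \in unitmx ->
  \sum_i (edge_row R uv *m invmx (edge_mx R F)) 0 i = 1.
Proof.
move=> F_free; set b := _ *m invmx _.
pose u : 'cV[R]_(n + 1) := col_mx 0 1%:M.
have edge_u p : edge_row R p *m u = 1%:M.
  rewrite /edge_row /vertex_row add_row_mx mul_row_col mulmx0 add0r mulmx1 -raddfD.
  by congr (_ %:M); field.
have Mu : edge_mx R F *m u = const_mx 1.
  apply/row_matrixP=> k; rewrite row_mul rowK edge_u row_const.
  by apply/matrixP => i j; rewrite !ord1 !mxE.
have : b *m edge_mx R F *m u = 1%:M by rewrite mulmxKV.
rewrite -mulmxA Mu => /(congr1 (fun A : 'M_1 => A 0 0)).
rewrite [RHS]mxE eqxx mulr1n mxE => <-.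
by apply: eq_bigr => i _; rewrite [const_mx _ _ _]mxE mulr1.
Qed.

Lemma add_edge F l uv c :
  basis_adj F -> edge_mx R F \in unitmx -> (forall i, 0 <= l 0 i) ->
  adj uv -> 0 <= c ->
  exists F' l', [/\ basis_adj F', edge_mx R F' \in unitmx,
    forall i, 0 <= l' 0 i & l *m edge_mx R F + c *: edge_row R uv = l' *m edge_mx R F'].
Proof.
move=> F_adj F_free l_ge0 uv_adj c_ge0.
have [b bM] : exists b, b *m edge_mx R F = edge_row R uv.
  by exists (edge_row R uv *m invmx (edge_mx R F)); rewrite mulmxKV.
have -> : l *m edge_mx R F + c *: edge_row R uv = (l + c *: b) *m edge_mx R F.
  by rewrite mulmxDl -scalemxAl bM.
have [/forallP L_ge0|/forallPn[i0]] := boolP [forall i, 0 <= (l + c *: b) 0 i].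
  by exists F, (l + c *: b).
rewrite -ltNge !mxE => L_lt0.
have [|k [bk_gt0 min_k]] := @min_ratio R (n + 1) l (- b) l_ge0.
  exists i0; rewrite mxE oppr_gt0; have := l_ge0 i0; nra.
rewrite mxE oppr_gt0 in bk_gt0.
have bk0 : b 0 k != 0 by rewrite lt_eqF.
(* [s] is the excess of [c] over the threshold [l 0 k / - b 0 k] of the ratio test. It is
   nonnegative because coordinate [i0] is already negative at [c]. *)
pose s := c + l 0 k / b 0 k.
have coordE i : (l + c *: b) 0 i - s * b 0 i = l 0 i - l 0 k / (- b) 0 k * (- b) 0 i.
  by rewrite /s !mxE; field.
exists (fun i => if i == k then uv else F i).
exists (\row_i (if i == k then s else (l + c *: b) 0 i - s * b 0 i)); split.
- by move=> i; case: eqP.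
- rewrite edge_mx_exchange -bM unitmxE det_row_exchange unitrM -unitmxE F_free.
  by rewrite unitfE bk0.
- move=> i; rewrite mxE; case: eqP => _; last by rewrite coordE.
  have := min_k i0; rewrite !mxE /s; move: L_lt0 (l_ge0 i0) c_ge0.
  rewrite !invrN !mulrN !mulNr opprK; move: (l 0 k / b 0 k) => t; nra.
- rewrite edge_mx_exchange -bM; apply: mul_row_exchange.
  by rewrite /s !mxE; field.
Qed.

(** Caratheodory's theorem for cones: edge vectors are added one at a time, pivoting whenever a
    coordinate would become negative. *)
Lemma simplicial_cone m (p : 'I_m -> V * V) (c : 'I_m -> R) :
  (forall i, adj (p i)) -> (forall i, 0 <= c i) ->
  exists F l, [/\ basis_adj F, edge_mx R F \in unitmx,
    forall i, 0 <= l 0 i & \sum_i c i *: edge_row R (p i) = l *m edge_mx R F].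
Proof.
elim: m p c => [|m IHm] p c p_adj c_ge0.
  exists base_edges, 0; rewrite edge_mx_unit det_base_edges big_ord0 mul0mx; split=> //.
    by move=> k; rewrite /base_edges; case: split => //.
  by move=> i; rewrite mxE.
rewrite big_ord_recr /=.
have [F [l [F_adj F_free l_ge0 ->]]] :=
  IHm _ _ (fun i => p_adj (widen_ord (leqnSn m) i)) (fun i => c_ge0 (widen_ord (leqnSn m) i)).
exact: add_edge.
Qed.

(** Induction on the absolute value of the determinant: the ratio test keeps the point in the cone,
    and the exchange multiplies that value by a coordinate strictly between 0 and 1. *)
Lemma unimodular_cone F l : odd_cycle_condition h ->
  basis_adj F -> edge_mx R F \in unitmx -> (forall i, 0 <= l 0 i) ->
  exists F' l', [/\ basis_adj F', absz (\det (edge_imx F')) = 1%N,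
    forall i, 0 <= l' 0 i & l *m edge_mx R F = l' *m edge_mx R F'].
Proof.
move=> occ; have [k] := ubnP (absz (\det (edge_imx F))).
elim: k F l => // k IHk F l lt_k F_adj F_free l_ge0.
have [det1|det_neq1] := eqVneq (absz (\det (edge_imx F))) 1%N; first by exists F, l.
have [uv [uv_adj b_lt1]] := reducing_edge h_sym h_irr F_adj F_free occ det_neq1.
set b := edge_row R uv *m invmx (edge_mx R F) in b_lt1.
have bM : b *m edge_mx R F = edge_row R uv by rewrite mulmxKV.
have [|i [bi_gt0 min_i]] := @min_ratio R (n + 1) l b l_ge0.
  apply: contrapT => no_pos; have := sum_coords_edge uv F_free; rewrite -/b.
  have : \sum_i b 0 i <= 0.
    by apply: sumr_le0 => i _; rewrite leNgt; apply/negP => bi; apply: no_pos; exists i.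
  by move=> /[swap] ->; rewrite ler10.
pose F' j := if j == i then uv else F j.
have F'M : edge_mx R F' = row_exchange (edge_mx R F) i (b *m edge_mx R F).
  by rewrite bM -edge_mx_exchange.
have F'_free : edge_mx R F' \in unitmx.
  by rewrite F'M unitmxE det_row_exchange unitrM -unitmxE F_free unitfE gt_eqF.
have lt_det : (absz (\det (edge_imx F')) < absz (\det (edge_imx F)))%N.
  rewrite -(ltr_nat R) !natr_absz !intr_norm -!det_edge_mx F'M det_row_exchange.
  by rewrite normrM gtr_pMl ?normr_gt0 -?unitfE -?unitmxE // gtr0_norm.
have li : l 0 i = l 0 i / b 0 i * b 0 i by rewrite divfK ?gt_eqF.
rewrite (mul_row_exchange (edge_mx R F) li).
rewrite -F'M; apply: IHk => //.
- by apply: leq_trans lt_det _; rewrite -ltnS.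
- by move=> j; rewrite /F'; case: eqP.
- by move=> j; rewrite mxE; case: eqP => _; [rewrite divr_ge0 // ltW|].
Qed.

End UnimodularCone.

(** * Stable set polytopes *)

Lemma sum_row_mx (R : nmodType) m n1 n2 (I : finType)
    (A : I -> 'M[R]_(m, n1)) (B : I -> 'M[R]_(m, n2)) :
  \sum_i row_mx (A i) (B i) = row_mx (\sum_i A i) (\sum_i B i).
Proof. by elim/big_rec3: _ => [|i a b c _ ->]; rewrite ?row_mx0 ?add_row_mx. Qed.

Section ZeroOnePolytopes.
Local Open Scope classical_set_scope.
Variables (R : realType) (n : nat).
Implicit Types (W : {set 'I_n}) (fam : pred {set 'I_n}).

Definition rho_int W : 'rV[int]_n := \row_j (j \in W)%:R.

Lemma rhoE W j : rho R W 0 j = (j \in W)%:R.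
Proof.
rewrite /rho summxE; under eq_bigr do rewrite mxE eqxx /=.
have [jW|jW] := boolP (j \in W).
  rewrite (bigD1 j) //= eqxx big1 ?addr0 // => i /andP[_ neq_ij].
  by rewrite eq_sym (negbTE neq_ij).
by rewrite big1 // => i iW; case: eqP => // ji; rewrite ji iW in jW.
Qed.

Lemma real_point_rho_int W : real_point R (rho_int W) = rho R W.
Proof. by apply/rowP=> j; rewrite rhoE !mxE; case: (j \in W). Qed.

Definition set_polytope fam : set 'rV[R]_n :=
  convex_hull [set v | exists2 W, fam W & v = rho R W].

Lemma convex_hullS (X Y : set 'rV[R]_n) : X `<=` Y -> convex_hull X `<=` convex_hull Y.
Proof.
move=> XY v [m [p [c [pX c0 c1 ->]]]].
by exists m, p, c; split=> // i; apply: XY.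
Qed.

Lemma sub_convex_hull (X : set 'rV[R]_n) : X `<=` convex_hull X.
Proof.
move=> v Xv; exists 1%N, (fun=> v), (fun=> 1); split=> //; last by rewrite big_ord1 scale1r.
by rewrite big_ord1.
Qed.

Lemma mem_convex_hull (I : finType) (X : set 'rV[R]_n) (P : pred I)
    (p : I -> 'rV[R]_n) (c : I -> R) :
  (forall i, P i -> X (p i)) -> (forall i, P i -> 0 <= c i) -> \sum_(i | P i) c i = 1 ->
  convex_hull X (\sum_(i | P i) c i *: p i).
Proof.
move=> pX c_ge0 c1.
exists #|[pred i | P i]|, (fun k => p (enum_val k)), (fun k => c (enum_val k)); split.
- by move=> k; apply: pX; have := enum_valP k.
- by move=> k; apply: c_ge0; have := enum_valP k.
- by rewrite -c1 -(big_enum_val (A := [pred i | P i]) c).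
- by rewrite -(big_enum_val (A := [pred i | P i]) (fun i => c i *: p i)).
Qed.

(** If the vertex of [W] has weight [c i0 > 0], coordinate [j] of the point is at least [c i0] for
    [j] in [W] and at most [1 - c i0] otherwise; an integer in the unit interval is then 1 or 0
    respectively. *)
Lemma lattice_points_set_polytope fam a :
  lattice_points (set_polytope fam) a <-> exists2 W, fam W & a = rho_int W.
Proof.
split=> [|[W famW ->]]; last first.
  by apply: sub_convex_hull; exists W; rewrite ?real_point_rho_int.
move=> [m [p [c [pX c_ge0 c1 pa]]]].
have [i0 ci0] : exists i0, 0 < c i0.
  apply: contrapT => c_le0; suff : \sum_i c i <= 0 by rewrite c1 ler10.
  by apply: sumr_le0 => i _; rewrite leNgt; apply/negP => ci; apply: c_le0; exists i.
have p01 i j : 0 <= p i 0 j <= 1.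
  by have [W _ ->] := pX i; rewrite rhoE; case: (j \in W); rewrite ?ler01 ?lexx.
have [W famW pW] := pX i0; exists W => //; apply/rowP=> j; rewrite mxE.
have /(congr1 (fun v : 'rV[R]_n => v 0 j)) := pa; rewrite mxE summxE => aj.
have {}aj : (a 0 j)%:~R = c i0 * (j \in W)%:R + \sum_(i | i != i0) c i * p i 0 j.
  rewrite aj (bigD1 i0) //= mxE pW rhoE; congr (_ + _).
  by apply: eq_bigr => i _; rewrite mxE.
have rest_ge0 : 0 <= \sum_(i | i != i0) c i * p i 0 j.
  by apply: sumr_ge0 => i _; rewrite mulr_ge0 //; case/andP: (p01 i j).
have rest_le : \sum_(i | i != i0) c i * p i 0 j <= 1 - c i0.
  rewrite -c1 [X in _ <= X - _](bigD1 i0) //= addrAC subrr add0r.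
  by apply: ler_sum => i _; rewrite ler_piMr //; case/andP: (p01 i j).
case: (j \in W) aj; rewrite ?mulr1 ?mulr0 => aj.
  have : 0 < a 0 j < 2 by rewrite -!(ltr_int R) aj; apply/andP; split; lra.
  lia.
have : -1 < a 0 j < 1 by rewrite -!(ltr_int R) aj; apply/andP; split; lra.
lia.
Qed.

End ZeroOnePolytopes.
Arguments set_polytope R {n} fam _.

Section StableSets.
Local Open Scope classical_set_scope.
Variables (R : realType) (n : nat) (e : rel 'I_n).
Hypothesis e_sym : symmetric e.
Hypothesis alpha2 : (stability_number e <= 2)%N.
Local Notation h := (compl_rel e).
Implicit Type W : {set 'I_n}.

Lemma compl_rel_sym : symmetric h.
Proof. by move=> i j; rewrite /compl_rel /= eq_sym e_sym. Qed.

Lemma compl_rel_irr : irreflexive h.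
Proof. by move=> i; rewrite /compl_rel /= eqxx. Qed.

Lemma stableP W :
  reflect {in W &, forall x y, x != y -> ~~ e x y} (stable e W).
Proof.
apply: (iffP forall_inP) => [st x y xW yW|st x xW].
  by move/forall_inP: (st x xW) => /(_ y yW)/implyP.
by apply/forall_inP=> y yW; apply/implyP; apply: st.
Qed.

Lemma stable0 : stable e finset.set0.
Proof. by apply/stableP => x; rewrite inE. Qed.

Lemma stable1 i : stable e [set i]%SET.
Proof. by apply/stableP => x y; rewrite !inE => /eqP-> /eqP->; rewrite eqxx. Qed.

Lemma stable2 i j : h i j -> stable e [set i; j]%SET.
Proof.
case/andP=> neq_ij nij; apply/stableP => x y; rewrite !inE.
by case/orP=> /eqP-> /orP[] /eqP->; rewrite ?eqxx // => _; rewrite // e_sym.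
Qed.

Lemma card_stable W : stable e W -> (#|W| <= 2)%N.
Proof.
move=> stW; apply: leq_trans alpha2.
by rewrite /stability_number (bigD1 W) //= leq_maxl.
Qed.

Lemma card2_stable W : stable e W -> #|W| = 2%N ->
  exists i j, [/\ h i j, i != j & W = [set i; j]%SET].
Proof.
move=> /stableP stW /eqP/cards2P[i [j [neq_ij EW]]]; exists i, j; split=> //.
by rewrite /compl_rel /= neq_ij stW // EW !inE eqxx ?orbT.
Qed.

Lemma rho_int2 (i j : 'I_n) : i != j ->
  rho_int [set i; j]%SET = delta_mx 0 i + delta_mx 0 j :> 'rV_n.
Proof.
move=> neq_ij; apply/rowP=> k; rewrite !mxE !inE /=.
have [->|//] := eqVneq k i; first by rewrite (negbTE neq_ij).
by rewrite add0r.
Qed.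

Lemma rho_int1 (i : 'I_n) : rho_int [set i]%SET = delta_mx 0 i :> 'rV_n.
Proof. by apply/rowP=> k; rewrite !mxE !inE. Qed.

Lemma rho_int0 : rho_int finset.set0 = 0 :> 'rV_n.
Proof. by apply/rowP=> k; rewrite !mxE !inE. Qed.

(** The empty set corresponds to the loop at the apex, a singleton to an edge at the apex, a pair to
    an edge of [h]. *)
Lemma stable_edge_point W : stable e W ->
  exists2 uv, cone_adj h uv.1 uv.2 & rho_int W = edge_point uv.
Proof.
move=> stW; have := card_stable stW.
case EW: #|W| => [|[|[|]]] // _.
- by exists (None, None); rewrite // (cards0_eq EW) rho_int0 /edge_point addr0.
- have /cards1P[i ->] : #|W| == 1 by rewrite EW.
  by exists (Some i, None); rewrite // rho_int1 /edge_point addr0.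
- have [i [j [hij neq_ij ->]]] := card2_stable stW EW.
  by exists (Some i, Some j); rewrite // rho_int2.
Qed.

Lemma edge_point_stable uv : cone_adj h uv.1 uv.2 ->
  exists2 W, stable e W & edge_point uv = rho_int W.
Proof.
case: uv => [[i|] [j|]]; rewrite /cone_adj /edge_point /= => uv.
- exists [set i; j]%SET; first exact: stable2.
  by rewrite rho_int2 //; case/andP: uv.
- by exists [set i]%SET; rewrite ?stable1 ?rho_int1 ?addr0.
- by exists [set j]%SET; rewrite ?stable1 ?rho_int1 ?add0r.
- by exists finset.set0; rewrite ?stable0 ?rho_int0 ?addr0.
Qed.

Local Notation Q := (stable_set_polytope R e).

Lemma lattice_points_stable a :
  lattice_points Q a <-> exists2 W, stable e W & a = rho_int W.
Proof. exact: lattice_points_set_polytope. Qed.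

Lemma lattice_edge_point uv : cone_adj h uv.1 uv.2 -> lattice_points Q (edge_point uv).
Proof. by case/edge_point_stable=> W stW ->; apply/lattice_points_stable; exists W. Qed.

Lemma edge_polytopeE :
  edge_polytope R h = set_polytope R [pred W | stable e W & #|W| == 2%N].
Proof.
congr convex_hull; apply/seteqP; split=> v.
  case=> i [j [hij ->]]; have neq_ij : i != j by case/andP: hij.
  exists [set i; j]%SET; first by rewrite /= stable2 // cards2 neq_ij.
  by rewrite -real_point_rho_int rho_int2 // /real_point map_mxD !map_delta_mx.
case=> W /andP[stW /eqP cardW] ->.
have [i [j [hij neq_ij ->]]] := card2_stable stW cardW; exists i, j; split=> //.
by rewrite -real_point_rho_int rho_int2 // /real_point map_mxD !map_delta_mx.
Qed.

Section Simplex.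
Variable F : 'I_(n + 1) -> option 'I_n * option 'I_n.
Hypothesis F_adj : forall k, cone_adj h (F k).1 (F k).2.
Hypothesis F_det : absz (\det (edge_imx F)) = 1%N.

Definition simplex_vertices : seq 'rV[int]_n :=
  [seq edge_point (F k) | k <- enum 'I_(n + 1)].

Lemma size_simplex_vertices : size simplex_vertices = (n + 1)%N.
Proof. by rewrite size_map size_enum_ord. Qed.

Lemma nth_simplex_vertices (k : 'I_(n + 1)) : simplex_vertices`_k = edge_point (F k).
Proof. by rewrite (nth_map k) ?size_enum_ord // nth_ord_enum. Qed.

Lemma sum_simplex_vertices (M : nmodType) (G : 'I_(size simplex_vertices) -> M) :
  \sum_i G i = \sum_(k < n + 1) G (cast_ord (esym size_simplex_vertices) k).
Proof.
rewrite (reindex (cast_ord (esym size_simplex_vertices))) //.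
by exists (cast_ord size_simplex_vertices) => i _; rewrite ?cast_ordK ?cast_ordKV.
Qed.

Lemma edge_imx_unit : edge_imx F \in unitmx.
Proof.
by rewrite unitmxE; move: F_det; case: (\det _) => [[|[]]|[]].
Qed.

Lemma unimodular_simplex_vertices : unimodular_simplex Q simplex_vertices.
Proof.
have combE (c : 'I_(size simplex_vertices) -> int) :
    \sum_i c i *: homogenize simplex_vertices`_i =
    (\row_k c (cast_ord (esym size_simplex_vertices) k)) *m edge_imx F.
  rewrite sum_simplex_vertices mulmx_sum_row; apply: eq_bigr => k _.
  by rewrite mxE rowK nth_simplex_vertices.
split.
- by move=> a /mapP[k _ ->]; apply: lattice_edge_point.
- move=> c; rewrite combE => /(congr1 (mulmx^~ (invmx (edge_imx F)))).
  rewrite mulmxK ?edge_imx_unit // mul0mx => /rowP c0 i.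
  by have := c0 (cast_ord size_simplex_vertices i); rewrite !mxE cast_ordK.
- move=> w _.
  exists (fun i => (w *m invmx (edge_imx F)) 0 (cast_ord size_simplex_vertices i)).
  rewrite combE -[LHS](mulmxKV edge_imx_unit); congr (_ *m _).
  by apply/rowP=> k; rewrite [RHS]mxE cast_ordKV.
Qed.

Lemma mem_simplex_hull (x : 'rV[R]_n) (l : 'rV[R]_(n + 1)) :
  (forall k, 0 <= l 0 k) -> row_mx x 1%:M = l *m edge_mx R F ->
  simplex_hull R simplex_vertices x.
Proof.
move=> l_ge0; rewrite mulmx_sum_row.
under eq_bigr do
  rewrite rowK -map_homogenize_edge_point /homogenize map_row_mx map_mx1 scale_row_mx.
rewrite sum_row_mx => /eq_row_mx[-> l1].
apply: mem_convex_hull => //.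
  by move=> k _; exists (edge_point (F k)) => //; rewrite /=; apply: map_f; rewrite mem_enum.
have := congr1 (fun A : 'M_1 => A 0 0) l1; rewrite summxE [LHS]mxE eqxx mulr1n => ->.
by apply: eq_bigr => k _; rewrite !mxE eqxx mulr1n mulr1.
Qed.

End Simplex.

Lemma covering_of_odd_cycle_condition :
  odd_cycle_condition h -> has_unimodular_covering Q.
Proof.
(* All unimodular simplices are taken. A point [x] is located in one of them through a unimodular
   cone containing [row_mx x 1%:M]. *)
move=> occ; exists [set F | unimodular_simplex Q F]; split=> //.
apply/seteqP; split=> [x [F [F_lat _ _]]|x].
  apply: convex_hullS => v [a aF <-].
  have /lattice_points_stable[W stW ->] := F_lat a aF.
  by exists W; rewrite ?real_point_rho_int.
case=> m [p [c [pX c_ge0 c1 xE]]].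
have /choice[uv uvP] i :
    exists uv, cone_adj h uv.1 uv.2 /\ p i = real_point R (edge_point uv).
  have [W stW ->] := pX i; have [uv adj_uv EW] := stable_edge_point stW.
  by exists uv; rewrite -EW real_point_rho_int.
have [F [l [F_adj F_free l_ge0 coneE]]] :=
  simplicial_cone (fun i => (uvP i).1) c_ge0.
have [F' [l' [F'_adj F'_det l'_ge0 coneE']]] :=
  unimodular_cone compl_rel_sym compl_rel_irr occ F_adj F_free l_ge0.
exists (simplex_vertices F'); first exact: unimodular_simplex_vertices.
apply: mem_simplex_hull l'_ge0 _; rewrite -coneE' -coneE.
under [RHS]eq_bigr do
  rewrite -map_homogenize_edge_point /homogenize map_row_mx map_mx1 scale_row_mx.
rewrite sum_row_mx xE -scaler_suml c1 scale1r; congr row_mx.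
by apply: eq_bigr => i _; rewrite (uvP i).2.
Qed.

End StableSets.

(** * Saturated exponent monoids *)

(** [b a] is an index from [a] on where [g] is smallest; restarting just after it yields
    nondecreasing values. *)
Lemma nondecreasing_subsequence (g : nat -> nat) :
  exists2 s : nat -> nat, {homo s : a b / (a < b)%N} & {homo g \o s : a b / (a <= b)%N}.
Proof.
have /choice[b bP] a : exists b, (a <= b)%N /\ forall c, (a <= c)%N -> (g b <= g c)%N.
  have ex_v : exists v, `[< exists2 b, (a <= b)%N & g b = v >].
    by exists (g a); apply/asboolP; exists a.
  case: (ex_minnP ex_v) => v /asboolP[b le_ab <-] min_b; exists b; split=> // c le_ac.
  by apply: min_b; apply/asboolP; exists c.
pose start k := iter k (fun a => (b a).+1) 0%N.
exists (b \o start).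
  apply: homo_ltn => [y x z|k]; first exact: ltn_trans.
  by have [] := bP (start k.+1).
apply: homo_leq => [//|y x z|k /=]; first exact: leq_trans.
have [_ min_k] := bP (start k); apply: min_k.
have [le_k _] := bP (start k); have [le_k1 _] := bP (start k.+1).
exact: leq_trans le_k (ltnW le_k1).
Qed.

(** Subsequences are extracted for one coordinate after another; the first two terms of the last one
    are comparable. *)
Lemma dickson (I : finType) (f : nat -> I -> nat) :
  exists i j, (i < j)%N /\ forall l, (f i l <= f j l)%N.
Proof.
have [s s_incr s_mono] : exists2 s : nat -> nat, {homo s : a b / (a < b)%N} &
    forall l, l \in enum I -> {homo (fun a => f (s a) l) : a b / (a <= b)%N}.
  elim: (enum I) => [|l r [s s_incr s_mono]]; first by exists id.
  have [t t_incr t_mono] := nondecreasing_subsequence (fun a => f (s a) l).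
  exists (s \o t) => [a b /t_incr/s_incr //|l'].
  rewrite inE => /orP[/eqP->//|l'r] a b le_ab.
  apply: s_mono => //; move: le_ab; rewrite leq_eqVlt => /orP[/eqP->//|].
  by move/t_incr/ltnW.
exists (s 0%N), (s 1%N); split=> [|l]; first exact: s_incr.
by apply: s_mono; rewrite ?mem_enum.
Qed.

(** Binomial expansion: divisibility of [c * f ^+ j] by [g ^+ j] survives the division step from [f]
    to [f - g * t]. *)
Lemma quotient_exprB (A : comPzRingType) (c f g t : A) (q : nat -> A) k :
  (forall j, c * f ^+ j = g ^+ j * q j) ->
  c * (f - g * t) ^+ k =
  g ^+ k * \sum_(i < k.+1) (q (k - i)%N * (- t) ^+ i) *+ 'C(k, i).
Proof.
move=> cfE; rewrite exprDn !mulr_sumr; apply: eq_bigr => i _.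
rewrite !mulrnAr; congr (_ *+ _); rewrite [LHS]mulrA cfE -mulrN exprMn.
rewrite -[X in _ = g ^+ X * _](subnK (ltnSE (ltn_ord i))) exprD.
by rewrite -!mulrA; congr (_ * _); rewrite mulrCA.
Qed.

(** * Exponent monoids and polynomials supported on them *)

Section ExponentMonoid.
Variables (N : nat) (I : finType) (P : pred I) (x : I -> 'X_{1..N}).
Implicit Types (m : 'X_{1..N}) (c : I -> nat).

Definition comb c := (\sum_(i | P i) x i *+ c i)%MM.

Definition in_monoid m := exists c, m = comb c.

Lemma combE c j : comb c j = (\sum_(i | P i) x i j * c i)%N.
Proof. by rewrite mnm_sumE; apply: eq_bigr => i _; rewrite mulmnE. Qed.

Lemma in_monoid0 : in_monoid 0%MM.
Proof.
exists (fun=> 0%N); apply/mnmP=> j.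
by rewrite combE mnm0E big1 // => i; rewrite muln0.
Qed.

Lemma in_monoidD m1 m2 : in_monoid m1 -> in_monoid m2 -> in_monoid (m1 + m2)%MM.
Proof.
move=> [c1 ->] [c2 ->]; exists (fun i => c1 i + c2 i)%N; apply/mnmP=> j.
by rewrite mnmDE !combE -big_split /=; apply: eq_bigr => i _; rewrite mulnDr.
Qed.

Lemma in_monoidMn m k : in_monoid m -> in_monoid (m *+ k)%MM.
Proof.
move=> m_in; elim: k => [|k IHk]; first exact: in_monoid0.
by rewrite mulmS; apply: in_monoidD.
Qed.

Lemma in_monoid_sum (J : Type) (r : seq J) (Q : pred J) (F : J -> 'X_{1..N}) :
  (forall j, Q j -> in_monoid (F j)) -> in_monoid (\sum_(j <- r | Q j) F j)%MM.
Proof.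
move=> FP; elim/big_ind: _ => //; [exact: in_monoid0|exact: in_monoidD].
Qed.

Lemma in_monoid_gen i : P i -> in_monoid (x i).
Proof.
move=> Pi; exists (fun j => (j == i) : nat); apply/mnmP=> k; rewrite combE.
by rewrite (bigD1 i) //= eqxx muln1 big1 ?addn0 // => j /andP[_ /negbTE->]; rewrite muln0.
Qed.

Definition saturated := forall m k, (0 < k)%N -> in_monoid (m *+ k)%MM -> in_monoid m.

(** Dickson's lemma on the coefficients of the remainders gives [i < j] whose remainders differ by
    an element of the monoid. Subtracting the two relations leaves [(a - b) *+ (j - i)], and
    saturation removes the multiple. *)
Lemma saturated_quotient a b m0 : saturated ->
  (forall k, exists2 d, in_monoid d & (m0 + a *+ k = b *+ k + d)%MM) ->
  exists2 d, in_monoid d & a = (b + d)%MM.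
Proof.
move=> sat hk.
have /choice[c cP] k : exists c, (m0 + a *+ k = b *+ k + comb c)%MM.
  by have [d [c ->] E] := hk k; exists c.
have [i [j [lt_ij le_c]]] := dickson c.
pose k := (j - i)%N; have jE : j = (i + k)%N by rewrite subnKC // ltnW.
have k_gt0 : (0 < k)%N by rewrite subn_gt0.
pose d := comb (fun l => c j l - c i l)%N.
have akE l : (a l * k = b l * k + d l)%N.
  have /mnmP/(_ l) := cP i; have /mnmP/(_ l) := cP j.
  rewrite !mnmDE !mulmnE.
  have -> : comb (c j) l = (comb (c i) l + d l)%N.
    by rewrite !combE -big_split /=; apply: eq_bigr => u _; rewrite -mulnDr subnKC.
  rewrite jE; lia.
have le_ba : (b <= a)%MM.
  by apply/mnm_lepP=> l; have := akE l; nia.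
exists (a - b)%MM; last by rewrite addmC submK.
apply: (sat _ k) => //; exists (fun l => c j l - c i l)%N; apply/mnmP=> l.
by rewrite mulmnE mnmBE mulnBl akE addKn.
Qed.

Variable K : fieldType.
Implicit Types p q f g : {mpoly K[N]}.

Definition supported p := forall m, m \in msupp p -> in_monoid m.

Lemma supported0 : supported 0.
Proof. by move=> m; rewrite msupp0. Qed.

Lemma supportedC a : supported a%:MP.
Proof.
move=> m; rewrite msuppC; case: ifP => // _; rewrite inE => /eqP->.
exact: in_monoid0.
Qed.

Lemma supportedX m : in_monoid m -> supported 'X_[m].
Proof. by move=> m_in k; rewrite msuppX inE => /eqP->. Qed.

Lemma supportedD p q : supported p -> supported q -> supported (p + q).
Proof. by move=> pS qS m /msuppD_le; rewrite mem_cat => /orP[/pS|/qS]. Qed.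

Lemma supportedM p q : supported p -> supported q -> supported (p * q).
Proof.
move=> pS qS m /msuppM_le/allpairsP[[m1 m2] /= [/pS m1P /qS m2P ->]].
exact: in_monoidD.
Qed.

Lemma supportedZ a p : supported p -> supported (a *: p).
Proof. by move=> pS; rewrite -mul_mpolyC; apply: supportedM => //; apply: supportedC. Qed.

Lemma supportedXn p k : supported p -> supported (p ^+ k).
Proof.
move=> pS; elim: k => [|k IHk]; first exact: supportedC.
by rewrite exprS; apply: supportedM.
Qed.

Lemma supported_sum (J : Type) (r : seq J) (Q : pred J) (F : J -> {mpoly K[N]}) :
  (forall j, Q j -> supported (F j)) -> supported (\sum_(j <- r | Q j) F j).
Proof. by move=> FP; elim/big_ind: _ => //; [exact: supported0|exact: supportedD]. Qed.

Lemma supported_quotient f g (c : {mpoly K[N]}) :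
  saturated -> g != 0 -> c != 0 -> supported c ->
  (forall k, exists2 q, supported q & c * f ^+ k = g ^+ k * q) ->
  exists2 q, supported q & f = g * q.
Proof.
move=> sat g0 c0 cS; elim/mleadrect: f => f IHf fgq.
have [->|f0] := eqVneq f 0; first by exists 0; [exact: supported0|rewrite mulr0].
have /choice[q qP] k : exists q, supported q /\ c * f ^+ k = g ^+ k * q.
  by have [q] := fgq k; exists q.
have [k|m m_in fE] := @saturated_quotient (mlead f) (mlead g) (mlead c) sat.
  have [qS E] := qP k; exists (mlead (q k)).
    apply: qS; apply: mlead_supp; apply: contra_eq_neq E => ->.
    by rewrite mulr0 mulf_neq0 ?expf_neq0.
  have q0 : q k != 0.
    by apply: contra_eq_neq E => ->; rewrite mulr0 mulf_neq0 ?expf_neq0.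
  by have := congr1 (@mlead N K) E; rewrite !mleadM ?expf_neq0 // !mleadX.
(* With this [t], the product [g * t] has the leading term of [f]. *)
pose t : {mpoly K[N]} := (mleadc f / mleadc g) *: 'X_[m].
have tS : supported t by apply: supportedZ; apply: supportedX.
have lc0 : mleadc f / mleadc g != 0.
  by rewrite mulf_neq0 ?invr_eq0 ?mleadc_eq0.
have mlead_t : mlead t = m by rewrite mleadZ // mleadXm.
have t0 : t != 0 by rewrite -mleadc_eq0 mlead_t mcoeffZ mcoeffX eqxx mulr1.
have [f'0|f'0] := eqVneq (f - g * t) 0.
  by exists t => //; apply/eqP; rewrite -subr_eq0 f'0.
have [|k|q' q'S E] := IHf (f - g * t); last first.
- exists (q' + t); first exact: supportedD.
  by rewrite mulrDr -E subrK.
- exists (\sum_(i < k.+1) (q (k - i)%N * (- t) ^+ i) *+ 'C(k, i)).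
    apply: supported_sum => i _; rewrite -mulr_natl -mpolyC_nat.
    apply: supportedM; first exact: supportedC.
    apply: supportedM; first by case: (qP (k - i)%N).
    by apply: supportedXn; rewrite -scaleN1r; apply: supportedZ.
  by apply: quotient_exprB => j; case: (qP j).
(* The leading terms cancel, so the leading monomial drops strictly. *)
rewrite lt_neqAle; apply/andP; split.
  apply: contraNneq f'0 => E; rewrite -mleadc_eq0 E mcoeffB fE -mlead_t mleadcM.
  by rewrite mcoeffZ mlead_t mcoeffX eqxx mulr1 mulrC divfK ?mleadc_eq0 // -fE subrr.
have := mleadB_le f (g * t).
by rewrite mleadM // mlead_t -fE joinxx.
Qed.

End ExponentMonoid.

Section Exponents.
Variable n : nat.
Implicit Types (W : {set 'I_n}) (fam : pred {set 'I_n}) (m : 'X_{1..n.+1}).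
Local Notation widen i := (widen_ord (leqnSn n) i).

Lemma mnm_widenP m1 m2 :
  (forall i : 'I_n, m1 (widen i) = m2 (widen i)) -> m1 ord_max = m2 ord_max -> m1 = m2.
Proof.
move=> eq_w eq_max; apply/mnmP=> k; case: (unliftP ord_max k) => [i|] -> //.
have -> : lift ord_max i = widen i by apply: val_inj; exact: lift_max.
exact: eq_w.
Qed.

Definition mnm_widen (f : 'I_n -> nat) (t : nat) : 'X_{1..n.+1} :=
  [multinom (if unlift ord_max k is Some i then f i else t) | k < n.+1].

Lemma mnm_widen_max f t : mnm_widen f t ord_max = t.
Proof. by rewrite mnmE unlift_none. Qed.

Lemma mnm_widenE f t i : mnm_widen f t (widen i) = f i.
Proof.
have -> : widen i = lift ord_max i by apply: val_inj; rewrite [RHS]lift_max.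
by rewrite mnmE liftK.
Qed.

Definition exponent W : 'X_{1..n.+1} := mnm_widen (fun i => i \in W : nat) 1.

Lemma exponent_max W : exponent W ord_max = 1%N.
Proof. exact: mnm_widen_max. Qed.

Lemma exponentE W i : exponent W (widen i) = (i \in W).
Proof. exact: mnm_widenE. Qed.

Lemma comb_exponent_max fam c : comb fam exponent c ord_max = (\sum_(W | fam W) c W)%N.
Proof. by rewrite combE; apply: eq_bigr => W _; rewrite exponent_max mul1n. Qed.

Lemma comb_exponentE fam c i :
  comb fam exponent c (widen i) = (\sum_(W | fam W) (i \in W) * c W)%N.
Proof. by rewrite combE; apply: eq_bigr => W _; rewrite exponentE. Qed.

End Exponents.

(** * From a unimodular covering to saturation *)

Section SaturatedOfCovering.
Variables (R : realType) (n : nat) (e : rel 'I_n).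
Hypotheses (e_sym : symmetric e).
Local Notation Q := (stable_set_polytope R e).
Local Notation h := (compl_rel e).
Local Notation widen i := (widen_ord (leqnSn n) i).

Lemma polytope_lattice_full w : polytope_lattice Q w.
Proof.
pose F := @base_edges n.
have F_unit : edge_imx F \in unitmx by rewrite unitmxE det_base_edges unitr1.
exists (n + 1)%N, (fun k => homogenize (edge_point (F k))).
exists (fun k => (w *m invmx (edge_imx F)) 0 k).
split=> [k|].
  exists (edge_point (F k)) => //; apply: lattice_edge_point => //.
  by rewrite /F /base_edges; case: (split k).
rewrite -{1}(mulmxKV F_unit w) [LHS]mulmx_sum_row.
by apply: eq_bigr => k _; rewrite rowK.
Qed.

(** Spanning gives [B *m A = 1]; then [(A *m B - 1) *m A = 0], and independence of the rows gives
    [A *m B = 1]. *)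
Lemma unimodular_simplex_left_inverse F : unimodular_simplex Q F ->
  exists B, (\matrix_(j < size F) homogenize F`_j) *m B = 1%:M.
Proof.
case=> _ F_ind F_span; set A := \matrix_j _.
have /choice[b bP] (k : 'I_(n + 1)) : exists b : 'rV_(size F), b *m A = delta_mx 0 k.
  have [c cE] := F_span _ (polytope_lattice_full (delta_mx 0 k)).
  exists (\row_j c j); rewrite cE mulmx_sum_row.
  by apply: eq_bigr => j _; rewrite mxE rowK.
exists (\matrix_k b k); set B := \matrix_k _.
have BA : B *m A = 1%:M by apply/row_matrixP=> k; rewrite row_mul rowK bP row1.
have ABA : (A *m B - 1%:M) *m A = 0.
  by rewrite mulmxBl -mulmxA BA mulmx1 mul1mx subrr.
apply/eqP; rewrite -subr_eq0; apply/eqP/matrixP => j l; rewrite [RHS]mxE.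
apply: (F_ind (fun l => (A *m B - 1%:M) j l)).
have := congr1 (row j) ABA; rewrite row0 row_mul mulmx_sum_row => ABj.
rewrite -[RHS]ABj; by apply: eq_bigr => i _; rewrite rowK [in RHS]mxE.
Qed.

Lemma saturated_of_covering :
  has_unimodular_covering Q -> saturated (stable e) (@exponent n).
Proof.
move=> [C [C_unim C_cover]] m k k_gt0 [c mkE].
pose t := m ord_max.
have tE : (t * k)%N = (\sum_(W | stable e W) c W)%N.
  by rewrite -comb_exponent_max -mkE mulmnE.
have xE i : (m (widen i) * k)%N = (\sum_(W | stable e W) (i \in W) * c W)%N.
  by rewrite -comb_exponentE -mkE mulmnE.
have [t0|t_gt0] := posnP t.
  have c0 W : stable e W -> c W = 0%N.
    move: tE; rewrite t0 mul0n => /esym/eqP.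
    by rewrite sum_nat_eq0 => /forall_inP cW /cW/eqP.
  suff -> : m = 0%MM by apply: in_monoid0.
  apply: mnm_widenP => [i|]; rewrite mnm0E //.
  apply/eqP; rewrite -(eqn_pmul2r k_gt0) xE mul0n big1 // => W /c0->.
  by rewrite muln0.
have kt_neq0 : (k * t)%:R != 0 :> R by rewrite pnatr_eq0 -lt0n muln_gt0 k_gt0.
have t_neq0 : t%:R != 0 :> R by rewrite pnatr_eq0 -lt0n.
have k_neq0 : k%:R != 0 :> R by rewrite pnatr_eq0 -lt0n.
pose v : 'rV[R]_n := \row_i ((m (widen i))%:R / t%:R).
have vQ : Q v.
  have -> : v = \sum_(W | stable e W) ((c W)%:R / (k * t)%:R) *: rho R W.
    apply/rowP=> i; rewrite mxE summxE.
    have -> : (m (widen i))%:R = (\sum_(W | stable e W) (i \in W) * c W)%:R / k%:R :> R.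
      by rewrite -xE natrM mulfK.
    rewrite natr_sum mulr_suml mulr_suml; apply: eq_bigr => W _.
    rewrite mxE rhoE !natrM; field; apply/andP; split=> //.
  apply: mem_convex_hull => [W stW|W _|]; first by exists W.
    by rewrite divr_ge0 ?ler0n.
  by rewrite -mulr_suml -natr_sum -tE mulnC divff.
have := vQ; rewrite -{1}C_cover => -[F CF [r [p [a [pF a_ge0 a1 vE]]]]].
have [F_lat F_ind F_span] := C_unim F CF.
have [B AB] := unimodular_simplex_left_inverse (C_unim F CF).
set A := \matrix_j _ in AB.
have /choice[s sP] i : exists j : 'I_(size F), p i = real_point R F`_j.
  have [b /(nthP 0)[j lt_j <-] <-] := pF i.
  by exists (Ordinal lt_j).
(* The barycentric coordinates of [v], gathered because several [p i] may be the same vertex. *)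
pose l j := \sum_(i | s i == j) a i.
have [mu muE] := F_span _ (polytope_lattice_full
  (row_mx (\row_j (m (widen j))%:Z) (t%:Z)%:M)).
(* Both families express the same vector in the rows of [A], which [B] cancels. Hence the integral
   coordinates [mu] inherit the sign of [l]. *)
have lmu j : t%:R * l j = (mu j)%:~R.
  have rowsE : (\row_j (t%:R * l j)) *m map_mx intr A =
      (\row_j (mu j)%:~R) *m map_mx intr A :> 'rV[R]_(n + 1).
    have -> : (\row_j (mu j)%:~R) = map_mx intr (\row_j mu j) :> 'rV[R]_(size F).
      by apply/rowP=> i; rewrite !mxE.
    have rowA i :
        row i (map_mx intr A) = row_mx (real_point R F`_i) 1%:M :> 'rV[R]_(n + 1).
      by rewrite -map_row rowK /homogenize map_row_mx map_mx1.
    transitivity (t%:R *: \sum_i a i *: row_mx (p i) 1%:M).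
      rewrite mulmx_sum_row scaler_sumr (partition_big s predT) //=.
      apply: eq_bigr => i _; rewrite mxE rowA /l mulr_sumr scaler_suml.
      by apply: eq_bigr => i' /eqP <-; rewrite sP scalerA.
    under eq_bigr do rewrite scale_row_mx.
    rewrite sum_row_mx -vE -scaler_suml a1 scale1r scale_row_mx -map_mxM mulmx_sum_row.
    have -> : \sum_i (\row_j mu j) 0 i *: row i A = \sum_i mu i *: homogenize F`_i.
      by apply: eq_bigr => i _; rewrite mxE rowK.
    rewrite -muE map_row_mx; congr row_mx; apply/rowP=> i; rewrite !mxE.
      by rewrite mulrC divfK.
    by rewrite ord1 mulr1 mulr1n.
  have := congr1 (mulmx^~ (map_mx intr B)) rowsE.
  rewrite -!mulmxA -map_mxM AB map_mx1 !mulmx1 => /rowP/(_ j).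
  by rewrite !mxE.
have mu_ge0 j : 0 <= mu j.
  by rewrite -(ler0z R) -lmu mulr_ge0 ?ler0n // sumr_ge0.
have /choice[W WP] (j : 'I_(size F)) : exists W, stable e W /\ F`_j = rho_int W.
  have /lattice_points_stable[W stW EW] := F_lat _ (mem_nth 0 (ltn_ord j)).
  by exists W.
have -> : m = (\sum_j exponent (W j) *+ absz (mu j))%MM.
  have muZ j : (absz (mu j))%:Z = mu j by rewrite gez0_abs.
  have : \sum_j mu j *: homogenize F`_j =
      \sum_j row_mx (mu j *: rho_int (W j)) (mu j *: 1%:M).
    by apply: eq_bigr => j _; rewrite (WP j).2 /homogenize scale_row_mx.
  rewrite -muE sum_row_mx => /eq_row_mx[/rowP xmu /matrixP/(_ 0 0) tmu].
  apply: mnm_widenP => [i|]; rewrite mnm_sumE; apply/eqP; rewrite -eqz_nat.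
    have := xmu i; rewrite summxE mxE => ->; apply/eqP.
    rewrite -natz natr_sum; apply: eq_bigr => j _.
    by rewrite mulmnE exponentE natz PoszM muZ !mxE mulrC natz.
  move: tmu; rewrite summxE !mxE eqxx mulr1n -/t => ->; apply/eqP.
  rewrite -natz natr_sum; apply: eq_bigr => j _.
  by rewrite mulmnE exponent_max mul1n natz muZ !mxE eqxx mulr1.
apply: in_monoid_sum => j _; apply: in_monoidMn; apply: in_monoid_gen.
exact: (WP j).1.
Qed.

End SaturatedOfCovering.

(** * Toric rings *)

Lemma expf_mul_div (F : fieldType) (x y : F) d k : y != 0 -> (k <= d)%N ->
  y ^+ d * (x / y) ^+ k = y ^+ (d - k) * x ^+ k.
Proof.
move=> y0 le_kd; rewrite -{1}(subnK le_kd) exprD expr_div_n -mulrA.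
by congr (_ * _); rewrite mulrC divfK // expf_neq0.
Qed.

Lemma expf_cancel_div (F : fieldType) (x y a : F) k : y != 0 ->
  y ^+ k * (a * (x / y) ^+ k) = a * x ^+ k.
Proof. by move=> y0; rewrite mulrCA expr_div_n [_ * (_ / _)]mulrC divfK // expf_neq0. Qed.

Section ToricRing.
Variables (K : fieldType) (R : realType) (n : nat).
Local Notation widen i := (widen_ord (leqnSn n) i).
Local Notation tofrac := (@FracField.tofrac {mpoly K[n.+1]}).
Implicit Types (fam : pred {set 'I_n}) (W : {set 'I_n}) (f g : ratfun K n).

Lemma laurent_generator W :
  laurent_monomial K (rho_int W) * ratfun_t K n = tofrac 'X_[exponent W].
Proof.
rewrite mpolyXE_id big_ord_recr /= exponent_max expr1 rmorphM rmorph_prod.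
congr (_ * _); apply: eq_bigr => i _.
rewrite exponentE mxE /ratfun_x.
by case: (i \in W); rewrite ?expr1z ?expr0z ?expr1 ?expr0 ?rmorph1.
Qed.

(** Supported polynomials form an algebra containing the generators; conversely a monomial with
    exponent in the monoid is a product of generators. *)
Lemma toric_ring_supported fam f :
  toric_ring K (set_polytope R fam) f <->
  exists2 p, supported fam (@exponent n) p & f = tofrac p.
Proof.
split=> [|[p pS ->]].
  elim=> [c|_ [a aP ->]|_ _ _ [p pS ->] _ [q qS ->]|_ _ _ [p pS ->] _ [q qS ->]].
  - by exists c%:MP; first exact: supportedC.
  - have /lattice_points_set_polytope[W famW ->] := aP.
    exists 'X_[exponent W]; last exact: laurent_generator.
    by apply: supportedX; apply: in_monoid_gen.
  - by exists (p + q); [exact: supportedD | rewrite rmorphD].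
  - by exists (p * q); [exact: supportedM | rewrite rmorphM].
have const c : toric_ring K (set_polytope R fam) (tofrac c%:MP) by apply: subalg_scalar.
have gen W : fam W -> toric_ring K (set_polytope R fam) (tofrac 'X_[exponent W]).
  move=> famW; apply: subalg_gen; exists (rho_int W); last by rewrite laurent_generator.
  by apply/lattice_points_set_polytope; exists W.
rewrite (mpolyE p) rmorph_sum big_seq /=.
elim/big_ind: _ => [||m mp];
  [by have := const 0; rewrite mpolyC0 rmorph0 | exact: subalg_add |].
rewrite -mul_mpolyC rmorphM; apply: subalg_mul; first exact: const.
have [c ->] := pS m mp; rewrite /comb -mprodXnE rmorph_prod.
elim/big_ind: _ => [||W famW];
  [by have := const 1; rewrite mpolyC1 rmorph1 | exact: subalg_mul |].
rewrite rmorphXn; elim: (c W) => [|k IHk].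
  by have := const 1; rewrite mpolyC1 rmorph1.
by rewrite exprS; apply: subalg_mul => //; apply: gen.
Qed.

Lemma tofrac_div_eq (p q r : {mpoly K[n.+1]}) :
  q != 0 -> (tofrac p / tofrac q == tofrac r) = (p == q * r).
Proof.
move=> q0; have q0' : tofrac q != 0 by rewrite tofrac_eq0.
apply/eqP/eqP => [E|->]; last by rewrite rmorphM /= mulrC mulKf.
by apply/eqP; rewrite -tofrac_eq rmorphM /= -E mulrC divfK.
Qed.

(** With [d] the degree of the integral equation, [q ^+ d] clears the denominators of the powers up
    to [d], and the equation reduces higher powers to lower ones. *)
Lemma integral_powers fam (q : {mpoly K[n.+1]}) (u : ratfun K n) :
  q != 0 -> supported fam (@exponent n) q ->
  (exists2 p, supported fam (@exponent n) p & u = tofrac p / tofrac q) ->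
  integral_over (toric_ring K (set_polytope R fam)) u ->
  exists d, forall k,
    exists2 r, supported fam (@exponent n) r & tofrac (q ^+ d) * u ^+ k = tofrac r.
Proof.
move=> q0 qS [p pS uE] [P [P_monic P_coef P_root]].
have P0 : P != 0 by apply: monic_neq0.
pose d := (size P).-1; have sizeP : size P = d.+1 by rewrite polySpred.
exists d; elim/ltn_ind => k IHk.
have q0' : tofrac q != 0 by rewrite tofrac_eq0.
have [le_kd|lt_dk] := leqP k d.
  exists (q ^+ (d - k) * p ^+ k); first by apply: supportedM; apply: supportedXn.
  by rewrite rmorphM !rmorphXn /= uE; apply: expf_mul_div.
have ud : u ^+ d = - \sum_(i < d) P`_i * u ^+ i.
  move/eqP: P_root; rewrite horner_coef sizeP big_ord_recr /=.
  have -> : P`_d = 1 by have /monicP := P_monic; rewrite lead_coefE.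
  by rewrite mul1r addrC => /eqP; rewrite addr_eq0 => /eqP.
have -> : tofrac (q ^+ d) * u ^+ k =
    - \sum_(i < d) P`_i * (tofrac (q ^+ d) * u ^+ (i + (k - d))).
  rewrite -{1}(subnKC (ltnW lt_dk)) exprD ud mulNr mulrN mulr_suml mulr_sumr.
  by congr (- _); apply: eq_bigr => i _; rewrite exprD -mulrA mulrCA.
have /choice[a aP] i : exists a, supported fam (@exponent n) a /\ P`_i = tofrac a.
  by have [a] := (toric_ring_supported fam _).1 (P_coef i); exists a.
have lt_k (i : 'I_d) : (i + (k - d) < k)%N by have := ltn_ord i; lia.
have /choice[r rP] (i : 'I_d) : exists r, supported fam (@exponent n) r /\
    tofrac (q ^+ d) * u ^+ (i + (k - d)) = tofrac r.
  by have [r] := IHk _ (lt_k i); exists r.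
exists (\sum_(i < d) (- a i * r i)).
  apply: supported_sum => i _; rewrite mulNr -mulrN.
  apply: supportedM; first exact: (aP i).1.
  by rewrite -scaleN1r; apply: supportedZ; exact: (rP i).1.
rewrite rmorph_sum -sumrN; apply: eq_bigr => i _.
by rewrite (rP i).2 (aP i).2 rmorphM rmorphN mulNr.
Qed.

Lemma normal_of_saturated fam :
  saturated fam (@exponent n) -> normal_polytope K (set_polytope R fam).
Proof.
move=> sat _ _ /toric_ring_supported[p pS ->] /toric_ring_supported[q qS ->].
rewrite tofrac_eq0 => q0 integral_u; apply/toric_ring_supported.
have [|d dP] := integral_powers q0 qS _ integral_u; first by exists p.
have [||k|r rS E] := @supported_quotient _ _ _ _ _ p q (q ^+ d) sat q0.
- by rewrite expf_neq0.
- exact: supportedXn.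
- have [r rS E] := dP k; exists r => //.
  have q0' : tofrac q != 0 by rewrite tofrac_eq0.
  apply/eqP; rewrite -tofrac_eq !rmorphM !rmorphXn /= -E rmorphXn /=; apply/eqP.
  by rewrite expf_cancel_div.
by exists r => //; apply/eqP; rewrite tofrac_div_eq // E.
Qed.

End ToricRing.

Lemma sum_next (T : finType) (c : seq T) (F : T -> nat) :
  uniq c -> (\sum_(x <- c) F (next c x) = \sum_(x <- c) F x)%N.
Proof.
move=> Uc; rewrite -(big_map (next c) predT F); apply: perm_big.
apply: uniq_perm => //.
  by rewrite map_inj_uniq //; apply: can_inj (prev_next Uc).
move=> x; apply/mapP/idP => [[y yc ->]|xc]; first by rewrite mem_next.
by exists (prev c x); rewrite ?mem_prev // next_prev.
Qed.

Lemma sum_mem_seq (T : finType) (c : seq T) (x : T) :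
  uniq c -> (\sum_(y <- c) (x == y) = (x \in c))%N.
Proof.
move=> Uc; rewrite -(count_uniq_mem x Uc) -sum1_count [RHS]big_mkcond.
by apply: eq_bigr => y _ /=; rewrite eq_sym; case: (y == x).
Qed.

(** * Consequences of normality of the stable set polytope *)

Section NormalStableSetPolytope.
Variables (K : fieldType) (R : realType) (n : nat) (e : rel 'I_n).
Hypothesis e_sym : symmetric e.
Hypothesis alpha2 : (stability_number e <= 2)%N.
Local Notation h := (compl_rel e).
Local Notation Q := (stable_set_polytope R e).
Local Notation widen i := (widen_ord (leqnSn n) i).
Local Notation tofrac := (@FracField.tofrac {mpoly K[n.+1]}).

(* The defect [2 t - sum x_i] is nonnegative on stable sets, and zero on edges only. *)
Lemma defect_comb c :
  let m := comb (stable e) (@exponent n) c in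
  (2 * m ord_max = \sum_(i < n) m (widen i) + \sum_(W | stable e W) (2 - #|W|) * c W)%N.
Proof.
rewrite /= comb_exponent_max; under [X in (_ = X + _)%N]eq_bigr do rewrite comb_exponentE.
rewrite exchange_big /= -big_split big_distrr /=; apply: eq_bigr => W stW.
rewrite -big_distrl /= -mulnDl; congr (_ * _)%N.
by rewrite -big_mkcond sum1_card subnKC // (card_stable alpha2).
Qed.

(** Each vertex of the cycle lies on two of its edges, so the edge exponents add up to twice the
    indicator. *)
Lemma cycle_monomial c : odd_induced_cycle h c ->
  in_monoid (stable e) (@exponent n) (mnm_widen (fun i => 2 * (i \in c))%N (size c)).
Proof.
case=> -[_ /andP[cyc Uc] _] _.
have hc x : x \in c -> h x (next c x) by apply: next_cycle.
have -> : mnm_widen (fun i => 2 * (i \in c))%N (size c) =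
    (\sum_(x <- c) exponent [set x; next c x]%SET)%MM.
  apply: mnm_widenP => [i|]; rewrite mnm_sumE ?mnm_widenE ?mnm_widen_max; last first.
    by under eq_bigr do rewrite exponent_max; rewrite sum1_size.
  rewrite mul2n -addnn -{1}(sum_mem_seq i Uc) -(sum_mem_seq i Uc).
  rewrite -{2}(sum_next (fun y => i == y : nat) Uc) -big_split /=.
  rewrite [LHS]big_seq [RHS]big_seq.
  apply: eq_bigr => x xc; rewrite exponentE !inE.
  case: (i =P x) => [->|_] //=; case: eqP => // Ex.
  by have := hc x xc; rewrite -Ex compl_rel_irr.
rewrite big_seq; apply: in_monoid_sum => x xc; apply: in_monoid_gen.
exact: stable2 e_sym _ _ (hc x xc).
Qed.

Lemma odd_cycle_condition_of_normal :
  normal_polytope K Q -> odd_cycle_condition h.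
Proof.
move=> normQ c1 c2 c1P c2P.
have [[_ /andP[_ U1] _] odd1] := c1P; have [[_ /andP[_ U2] _] odd2] := c2P.
apply: contrapT => no_link.
have disj x : x \in c1 -> x \in c2 -> False.
  by move=> x1 x2; apply: no_link; left; exists x.
have no_bridge i j : h i j -> i \in c1 -> j \in c2 -> False.
  move=> hij i1 j2; apply: no_link; right; exists i, j; split=> //.
    by apply/negP; apply: disj.
  by apply/negP => j1; apply: (disj j).
(* [s] is the number of edges that a perfect matching of the two cycles would have; the total is
   even because both lengths are odd. *)
pose s := (size c1 + size c2)./2.
have sE : (size c1 + size c2 = s + s)%N.
  by rewrite addnn -[LHS]odd_double_half oddD odd1 odd2.
pose mu : 'X_{1..n.+1} := mnm_widen (fun i => (i \in c1) + (i \in c2))%N s.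
suff [c muE] : in_monoid (stable e) (@exponent n) mu.
  have sum_cycle (cc : seq 'I_n) : uniq cc -> (\sum_(i < n) (i \in cc) = size cc)%N.
    by move=> Ucc; rewrite -big_mkcond sum1_card; apply/card_uniqP.
  (* [mu] has defect zero, so only stable pairs occur in its decomposition. *)
  have defect0 W : stable e W -> c W != 0%N -> #|W| = 2%N.
    move=> stW cW; have /= := defect_comb c; rewrite -muE mnm_widen_max.
    under eq_bigr do rewrite mnm_widenE.
    rewrite big_split /= !sum_cycle // sE mul2n -addnn -[LHS]addn0 => /addnI/esym/eqP.
    rewrite sum_nat_eq0 => /forall_inP/(_ W stW).
    rewrite muln_eq0 (negbTE cW) orbF subn_eq0 => ge2.
    by apply/eqP; rewrite eqn_leq ge2 (card_stable alpha2).
  have mem_c W i : stable e W -> c W != 0%N -> i \in W -> (i \in c1) || (i \in c2).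
    move=> stW cW iW; have : (0 < mu (widen i))%N.
      rewrite muE comb_exponentE (bigD1 W) //= iW mul1n.
      by rewrite addn_gt0 lt0n cW.
    by rewrite mnm_widenE; case: (i \in c1) (i \in c2) => [] [].
  (* Parity contradiction: [c1] has odd total weight, while each pair that occurs has 0 or 2
     vertices in [c1], as no edge joins the two cycles. *)
  have : odd (\sum_(i in c1) mu (widen i))%N.
    rewrite (eq_bigr (fun=> 1%N)) => [|i i1]; last first.
      by rewrite mnm_widenE i1; case: (boolP (i \in c2)) => // /(disj i i1).
    by rewrite sum1_card; move/card_uniqP: U1 => ->.
  under eq_bigr do rewrite muE comb_exponentE.
  rewrite exchange_big /=; apply/negP.
  elim/big_ind: _ => //= [x y ox oy|W stW]; first by rewrite oddD (negbTE ox) (negbTE oy).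
  have [->|cW] := eqVneq (c W) 0%N; first by rewrite big1 // => i _; rewrite muln0.
  have [i [j [hij neq_ij EW]]] := card2_stable stW (defect0 W stW cW).
  have inW k : k \in W -> (k \in c1) || (k \in c2) by apply: mem_c.
  have [iW jW] : i \in W /\ j \in W by rewrite EW !inE !eqxx orbT.
  have ij1 : (i \in c1) = (j \in c1).
    apply/idP/idP => [i1|j1].
      by case/orP: (inW j jW) => // j2; case: (no_bridge i j).
    case/orP: (inW i iW) => // i2; case: (no_bridge j i) => //.
    by rewrite compl_rel_sym.
  rewrite -big_distrl /= oddM negb_and; apply/orP; left.
  rewrite -big_mkcondr /= sum1_card.
  have -> : #|[pred k in c1 | k \in W]| = (if i \in c1 then 2 else 0)%N.
    case: ifP => i1; last first.
      apply: eq_card0 => k; rewrite !inE EW !inE.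
      by apply/andP => -[k1 /orP[] /eqP Ek]; rewrite Ek -?ij1 i1 in k1.
    rewrite -(defect0 W stW cW); apply: eq_card => k; rewrite !inE EW !inE.
    case: eqP => [->|_]; first by rewrite i1.
    by case: eqP => [->|_]; rewrite ?andbF // -ij1 i1.
  by case: ifP.
pose S := toric_ring K Q.
have S_mon m : in_monoid (stable e) (@exponent n) m -> S (tofrac 'X_[m]).
  by move=> m_in; apply/toric_ring_supported; exists 'X_[m] => //; apply: supportedX.
(* Adding [s] copies of the empty set turns [mu] into a sum of singletons, which exhibits the
   monomial as a quotient of ring elements. *)
pose den := (exponent (@finset.set0 'I_n) *+ s)%MM.
have den_in : in_monoid (stable e) (@exponent n) den.
  by apply: in_monoidMn; apply: in_monoid_gen; apply: stable0.
have num_in : in_monoid (stable e) (@exponent n) (mu + den)%MM.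
  suff -> : (mu + den = \sum_(x <- c1) exponent [set x]%SET +
                        \sum_(x <- c2) exponent [set x]%SET)%MM.
    apply: in_monoidD; apply: in_monoid_sum => x _; apply: in_monoid_gen;
      exact: stable1.
  apply: mnm_widenP => [i|]; rewrite !mnmDE mulmnE !mnm_sumE.
    rewrite exponentE inE mul0n addn0 mnm_widenE -(sum_mem_seq i U1) -(sum_mem_seq i U2).
    by congr (_ + _)%N; apply: eq_bigr => x _; rewrite exponentE inE.
  have sum_max (c : seq 'I_n) : (\sum_(x <- c) exponent [set x]%SET ord_max = size c)%N.
    by under eq_bigr do rewrite exponent_max; rewrite sum1_size.
  by rewrite !sum_max sE exponent_max mul1n mnm_widen_max.
have mu2_in : in_monoid (stable e) (@exponent n) (mu *+ 2)%MM.
  suff -> : (mu *+ 2 = mnm_widen (fun i => 2 * (i \in c1))%N (size c1) +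
                      mnm_widen (fun i => 2 * (i \in c2))%N (size c2))%MM.
    by apply: in_monoidD; apply: cycle_monomial.
  apply: mnm_widenP => [i|]; rewrite mulmnE mnmDE ?mnm_widenE ?mnm_widen_max.
    by rewrite muln2 -mul2n mulnDr.
  by rewrite sE muln2 addnn.
have quotE : tofrac 'X_[mu + den] / tofrac 'X_[den] = tofrac 'X_[mu].
  apply/eqP; rewrite tofrac_div_eq; first by rewrite mpolyXD mulrC.
  by rewrite -msupp_eq0 msuppX.
have : S (tofrac 'X_[mu]).
  rewrite -quotE; apply: normQ; [exact: S_mon|exact: S_mon| |].
    by rewrite tofrac_eq0 -msupp_eq0 msuppX.
  rewrite quotE; set u := tofrac 'X_[mu].
  exists ('X^2 - (u ^+ 2)%:P); split; first exact: monicXnsubC.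
    have Sc c : S (tofrac c%:MP) by apply: subalg_scalar.
    have S0 : S 0 by have := Sc 0; rewrite mpolyC0 rmorph0.
    have Su2 : S (- u ^+ 2).
      rewrite -[X in S X]mulN1r; apply: subalg_mul.
        by have := Sc (-1); rewrite mpolyCN mpolyC1 rmorphN rmorph1.
      by rewrite -rmorphXn mpolyXn; apply: S_mon.
    move=> i; rewrite coefB coefXn coefC; apply: subalg_add.
      by case: (i == 2); [have := Sc 1; rewrite mpolyC1 rmorph1|].
    by case: (i == 0)%N; rewrite ?oppr0.
  by rewrite rootE !hornerE subrr.
case/toric_ring_supported=> p pS /eqP; rewrite tofrac_eq => /eqP Ep.
by apply: pS; rewrite -Ep msuppX inE.
Qed.

(** * The edge polytope as a face *)

Local Notation edges := [pred W : {set 'I_n} | stable e W & #|W| == 2%N].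

(* [flat] cuts out the face [P_h] of [Q_G], on which [sum x_i = 2 t]. *)
Definition flat (m : 'X_{1..n.+1}) : bool :=
  (2 * m ord_max == \sum_(i < n) m (widen i))%N.

Lemma in_monoid_le m : in_monoid (stable e) (@exponent n) m ->
  (\sum_(i < n) m (widen i) <= 2 * m ord_max)%N.
Proof. by case=> c ->; rewrite defect_comb leq_addr. Qed.

Lemma in_monoid_edges m :
  in_monoid edges (@exponent n) m <-> in_monoid (stable e) (@exponent n) m /\ flat m.
Proof.
split=> [[c ->]|[[c ->]]].
  pose c' (W : {set 'I_n}) := if #|W| == 2%N then c W else 0%N.
  have -> : comb edges (@exponent n) c = comb (stable e) (@exponent n) c'.
    apply/mnmP=> j; rewrite !combE [LHS]big_mkcondr /=; apply: eq_bigr => W _.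
    by rewrite /c'; case: ifP; rewrite ?muln0.
  split; first by exists c'.
  rewrite /flat defect_comb -[X in _ == X]addn0 eqn_add2l sum_nat_eq0.
  by apply/forall_inP=> W _; rewrite /c'; have [->|] := eqVneq #|W| 2%N; rewrite ?muln0.
rewrite /flat defect_comb -[X in _ == X]addn0 eqn_add2l sum_nat_eq0 => /forall_inP c0.
exists c; apply/mnmP=> j; rewrite !combE [RHS]big_mkcondr /=; apply: eq_bigr => W stW.
case: ifP => // /negbT W2; have := c0 W stW.
rewrite muln_eq0 => /orP[|/eqP->]; rewrite ?muln0 //.
by rewrite subn_eq0 => ge2; rewrite eqn_leq ge2 (card_stable alpha2) in W2.
Qed.

(** The defects are nonnegative and additive, so their sum vanishes only if both do. *)
Lemma flatD m1 m2 : in_monoid (stable e) (@exponent n) m1 ->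
  in_monoid (stable e) (@exponent n) m2 -> flat (m1 + m2) = flat m1 && flat m2.
Proof.
move=> /in_monoid_le le1 /in_monoid_le le2; rewrite /flat mnmDE.
under eq_bigr do rewrite mnmDE.
rewrite big_split /= mulnDr.
move: (\sum_(i < n) m1 _)%N (\sum_(i < n) m2 _)%N le1 le2 => a b le1 le2.
by apply/eqP/andP => [E|[/eqP-> /eqP->]//]; split; apply/eqP; lia.
Qed.

Lemma msupp_sum_all (J : Type) (r : seq J) (P : pred J)
    (F : J -> {mpoly K[n.+1]}) (T : 'X_{1..n.+1} -> Prop) :
  (forall j, P j -> forall m, m \in msupp (F j) -> T m) ->
  forall m, m \in msupp (\sum_(j <- r | P j) F j) -> T m.
Proof.
move=> FT; elim/big_ind: _ => [m|p q pT qT m /msuppD_le|//]; first by rewrite msupp0.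
by rewrite mem_cat => /orP[/pT|/qT].
Qed.

(** Split [r] into its flat part [r0] and the rest [r1]. All monomials of [q * r1] are non-flat,
    those of [p - q * r0] are flat, and the two are equal, hence zero. *)
Lemma supported_edges_quotient p q r :
  q != 0 -> supported edges (@exponent n) p -> supported edges (@exponent n) q ->
  supported (stable e) (@exponent n) r -> p = q * r :> {mpoly K[n.+1]} ->
  supported edges (@exponent n) r.
Proof.
move=> q0 pS qS rS pE.
pose r0 := \sum_(m <- msupp r | flat m && (m \in msupp r)) r@_m *: 'X_[m].
pose r1 := \sum_(m <- msupp r | ~~ flat m && (m \in msupp r)) r@_m *: 'X_[m].
have rE : r = r0 + r1.
  rewrite {1}(mpolyE r) (bigID flat) /= big_seq_cond [X in _ + X = _]big_seq_cond.
  by congr (_ + _); apply: eq_bigl => m; rewrite andbC.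
have r0S m : m \in msupp r0 -> flat m /\ in_monoid (stable e) (@exponent n) m.
  move: m; apply: msupp_sum_all => k /andP[fk kr] m /msuppZ_le.
  by rewrite msuppX inE => /eqP->; split=> //; apply: rS.
have r1S m : m \in msupp r1 -> ~~ flat m /\ in_monoid (stable e) (@exponent n) m.
  move: m; apply: msupp_sum_all => k /andP[fk kr] m /msuppZ_le.
  by rewrite msuppX inE => /eqP->; split=> //; apply: rS.
suff r1_0 : r1 = 0.
  by move=> m; rewrite rE r1_0 addr0 => /r0S[fm m_in]; apply/in_monoid_edges.
apply/eqP; rewrite -(mulrI_eq0 _ (mulfI q0)); apply: contrapT => /negP qr1_0.
have := mlead_supp qr1_0; set m := mlead _ => m_in.
have nflat : ~~ flat m.
  move: m_in => /msuppM_le/allpairsP[[m1 m2] /=].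
  case=> /qS/in_monoid_edges[m1_in _] /r1S[nf m2_in] ->.
  by rewrite flatD // negb_and nf orbT.
have qr1E : q * r1 = p - q * r0 by rewrite pE rE mulrDr addrC addKr.
move: m_in; rewrite qr1E => /msuppB_le; rewrite mem_cat => /orP[/pS/in_monoid_edges[_ fm]|].
  by rewrite fm in nflat.
case/msuppM_le/allpairsP=> -[m1 m2] /= [/qS/in_monoid_edges[m1_in f1] /r0S[f2 m2_in] Em].
by rewrite Em flatD // f1 f2 in nflat.
Qed.

Lemma integral_overS (L : fieldType) (A B : set L) u :
  (A `<=` B)%classic -> integral_over A u -> integral_over B u.
Proof. by move=> AB [p [p_monic pA pu]]; exists p; split=> // i; apply: AB. Qed.

(** Integrality over the subring of the face passes to the larger toric ring; normality there yields
    a quotient, which the face property brings back to the subring. *)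
Lemma edge_polytope_normal :
  normal_polytope K Q -> normal_polytope K (edge_polytope R h).
Proof.
move=> normQ; rewrite (edge_polytopeE R e_sym).
have sub : (toric_ring K (set_polytope R edges) `<=` toric_ring K Q)%classic.
  move=> f /toric_ring_supported[p pS ->]; apply/toric_ring_supported; exists p => //.
  by move=> m /pS/in_monoid_edges[].
move=> f g fS gS; have fQ := sub _ fS; have gQ := sub _ gS.
move=> g0 /(integral_overS sub)/(normQ _ _ fQ gQ g0)/toric_ring_supported[r rS fgE].
case/toric_ring_supported: fS fgE g0 => p pS ->; case/toric_ring_supported: gS => q qS ->.
rewrite tofrac_eq0 => /eqP + q0; rewrite tofrac_div_eq // => /eqP pE.
apply/toric_ring_supported; exists r; first exact: supported_edges_quotient pE.
by apply/eqP; rewrite tofrac_div_eq // pE.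
Qed.

(** A triangle of the complement would be a stable set with three elements. *)
Lemma odd_induced_cycle_hole c : odd_induced_cycle h c -> odd_hole h c.
Proof.
case=> -[size3 cyc ind] odd_c; split=> //; split=> //.
rewrite ltn_neqAle size3 andbT; apply/eqP => size_c.
case: c size_c cyc {ind odd_c size3} => [|x [|y [|z []]]] //= _.
rewrite /ucycle /= !inE => /andP[/and4P[hxy hyz hzx _] /and3P[/norP[xy xz] yz _]].
have : (#|[set x; y; z]%SET| <= 2)%N.
  apply: (card_stable alpha2); apply/stableP => a b; rewrite !inE -!orbA.
  move: hxy hyz hzx => /andP[_ xy'] /andP[_ yz'] /andP[_ zx'].
  by case/or3P=> /eqP-> /or3P[] /eqP->; rewrite ?eqxx // e_sym.
by rewrite -finset.setUA cardsU1 cards2 !inE negb_or xy xz yz.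
Qed.

End NormalStableSetPolytope.

Local Close Scope ring_scope.

Theorem theorem2p1 (K : fieldType) (R : realType) (n : nat) (e : rel 'I_n)
    (e_sym : symmetric e) (e_irr : irreflexive e)
    (alpha2 : stability_number e = 2) :
  [/\ normal_polytope K (stable_set_polytope R e) <->
        has_unimodular_covering (stable_set_polytope R e),
      has_unimodular_covering (stable_set_polytope R e) <->
        odd_cycle_condition (compl_rel e),
      odd_cycle_condition (compl_rel e) <->
        (forall c1 c2 : seq 'I_n,
           odd_hole (compl_rel e) c1 -> odd_hole (compl_rel e) c2 ->
           ~ common_vertex c1 c2 -> has_bridge (compl_rel e) c1 c2) &
      normal_polytope K (stable_set_polytope R e) ->
        normal_polytope K (edge_polytope R (compl_rel e))].
Proof.
have le2 : (stability_number e <= 2)%N by rewrite alpha2.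
have normal_occ := @odd_cycle_condition_of_normal K R n e e_sym le2.
have occ_cover := @covering_of_odd_cycle_condition R n e e_sym le2.
have cover_normal : has_unimodular_covering (stable_set_polytope R e) ->
    normal_polytope K (stable_set_polytope R e).
  by move=> cover; apply: (@normal_of_saturated K R n); apply: saturated_of_covering cover.
split.
- by split=> [/normal_occ/occ_cover|].
- by split=> [/cover_normal/normal_occ|].
- split=> [occ c1 c2 [[ind1 _] odd1] [[ind2 _] odd2] disj|holes c1 c2 c1P c2P].
    by case: (occ c1 c2).
  have [common|disj] := pselect (common_vertex c1 c2); [by left | right].
  by apply: holes => //; apply: odd_induced_cycle_hole.
- exact: edge_polytope_normal.
Qed.
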